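(* Let $\mathcal F$ be a singular foliation on a smooth manifold $M$ that admits a geometric resolution of finite length. Let $m\in M$ and let $r$ be the rank of $\mathcal F$ at $m$. If the NMRLA $3$-class of $\mathcal F$ at $m$ does not vanish, then there is no Lie algebroid $(A,[\cdot,\cdot],\rho)$ defined over a neighborhood $U_m$ of $m$ satisfying both: 1. the rank of the vector bundle $A$ is $r$, and 2. $\rho(\Gamma(A))=\mathcal F|_{U_m}$.
   Context: $\mathscr O$: smooth functions on $M$; $\Gamma(\cdot)$: sheaves of sections. A singular foliation is a subsheaf $\mathcal F$ of the sheaf of vector fields consisting of $\mathscr O$-modules, closed under Lie bracket and locally finitely generated. Its rank at $m$ is the minimal number of generators of $\mathcal F$ (as $\mathscr O$-module) in a neighborhood of $m$. Geometric resolution $(E,\mathrm d,\rho)$ of $\mathcal F$: vector bundles $E_{-i}$, $i\ge1$, vector bundle morphisms $\mathrm d^{(i)}:E_{-i}\to E_{-i+1}$ ($i\ge2$), $\rho:E_{-1}\to TM$ over the identity with $\cdots\to\Gamma(E_{-2})\xrightarrow{\mathrm d^{(2)}}\Gamma(E_{-1})\xrightarrow{\rho}\mathcal F\to0$ an exact sequence of sheaves. Finite length: $E_{-i}=0$ for $i$ large. Minimal at $m$: $\mathrm d^{(i)}_m=0$ for all $i\ge2$. A finite length resolution can be replaced, near $m$, by one minimal at $m$. Lie $\infty$-algebra: graded vector space $V=\bigoplus_{i\ge1}V_{-i}$ with graded-symmetric $n$-ary brackets $\{\dots\}_n$ ($n\ge1$) of degree $+1$ with $\sum_{i=1}^n\sum_{\sigma\in\mathrm{Un}(i,n-i)}\epsilon(\sigma)\{\{x_{\sigma(1)},\dots,x_{\sigma(i)}\}_i,x_{\sigma(i+1)},\dots,x_{\sigma(n)}\}_{n-i+1}=0$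 for all $n\ge1$ (unshuffles, Koszul sign). Lie $\infty$-algebroid: vector bundles $E=(E_{-i})_{i\ge1}$ with a Lie $\infty$-algebra structure on sections and an anchor $\rho:E_{-1}\to TM$, all brackets $\mathscr O$-multilinear except $\{x,fy\}_2=f\{x,y\}_2+\rho(x)[f]y$ for $x\in\Gamma(E_{-1})$. It is universal for $\mathcal F$ if its linear part $(E,\mathrm d=\{\cdot\}_1,\rho)$ is a geometric resolution of $\mathcal F$; minimal at $m$ if that resolution is. Every geometric resolution underlies a universal Lie $\infty$-algebroid. NMRLA class: choose a universal Lie $\infty$-algebroid of $\mathcal F$ near $m$, minimal at $m$. Put $H^{-1}(\mathcal F,m)=\ker(\rho_m)$, $H^{-2}(\mathcal F,m)=E_{-2}|_m$. The brackets induce, by extending elements to local sections, bracketing and evaluating at $m$: a Lie algebra bracket $\{\cdot,\cdot\}_2$ on $H^{-1}(\mathcal F,m)$, an $H^{-1}(\mathcal F,m)$-module structure $\{\cdot,\cdot\}_2$ on $H^{-2}(\mathcal F,m)$, and a map $\{\cdot,\cdot,\cdot\}_3:\Lambda^3H^{-1}(\mathcal F,m)\to H^{-2}(\mathcal F,m)$ which is a Chevalley–Eilenberg $3$-cocycle. Its class in the third Chevalley–Eilenberg cohomology of $H^{-1}(\mathcal F,m)$ with values in $H^{-2}(\mathcal F,m)$, which is independent of the choices, is the NMRLA (''No-Minimal-Rank-Lie-Algebroid'') $3$-class of $\mathcal F$ at $m$. *)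

(* Defs.v *)
From HB Require Import structures.
From mathcomp Require Import all_boot all_order all_algebra all_fingroup.
From mathcomp Require Import all_classical all_reals all_analysis.

Set Implicit Arguments.
Unset Strict Implicit.
Unset Printing Implicit Defensive.

Import Order.TTheory GRing.Theory Num.Theory.
Import numFieldNormedType.Exports.

Local Open Scope classical_set_scope.
Local Open Scope ring_scope.

(* Sheaf conventions.  A function, vector field or section over an open set V
   is represented by a function defined on all of M; only its values on V
   matter, and conditions are imposed only over V.  Accordingly a morphism of
   sheaves is one operator on such functions which respects smoothness on
   every open set and equality on every open set (its "locality" axiom), i.e.
   a family of maps of sections compatible with restrictions. *)

Section Manifolds.
Variable R : realType.

Fixpoint Ck (k n : nat) (O : set 'rV[R]_n) (f : 'rV[R]_n -> R) : Prop :=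
  (forall x, O x -> {for x, continuous f}) /\
  if k is k'.+1 then
    forall i : 'I_n,
      (forall x, O x -> derivable f x (delta_mx 0 i)) /\
      Ck k' O (fun x => 'D_(delta_mx 0 i) f x)
  else True.

Definition Cinfty (n : nat) (O : set 'rV[R]_n) (f : 'rV[R]_n -> R) : Prop :=
  forall k, Ck k O f.

(* [cinv] is meaningful on the image of [cdom] only. *)
Record chart (T : topologicalType) (n : nat) := Chart {
  cdom : set T;
  cmap : T -> 'rV[R]_n;
  cinv : 'rV[R]_n -> T;
  cdom_open : open cdom;
  cimg_open : open (cmap @` cdom);
  cmapK : {in cdom, cancel cmap cinv};
  cmap_cont : forall x, cdom x -> {for x, continuous cmap};
  cinv_cont : forall y, (cmap @` cdom) y -> {for y, continuous cinv} }.

Record manifold := Manifold {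
  mspace :> topologicalType;
  mdim : nat;
  mhausdorff : hausdorff_space mspace;
  mcountable : @second_countable mspace;
  atlas : set (chart mspace mdim);
  atlas_cover : forall x : mspace, exists2 c, atlas c & cdom c x;
  atlas_smooth : forall c d (i : 'I_mdim), atlas c -> atlas d ->
    Cinfty (cmap c @` (cdom c `&` cdom d)) (fun y => cmap d (cinv c y) 0 i) }.

End Manifolds.

Section SmoothFunctions.
Variables (R : realType) (M : manifold R).

Definition smooth_on (V : set M) (f : M -> R) : Prop :=
  forall c, atlas c -> Cinfty (cmap c @` (V `&` cdom c)) (f \o cinv c).

Definition smooth_near (x : M) (f : M -> R) : Prop :=
  exists V : set M, [/\ open V, V x & smooth_on V f].

(* [P] holds on some neighbourhood, inside [V], of every point of [V]. *)
Definition locally_on (V : set M) (P : set M -> Prop) : Prop :=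
  forall x, V x -> exists W : set M, [/\ open W, W x, W `<=` V & P W].

(* Tangent vectors are derivations of the germs of smooth functions; the value
   of [v] at functions that are not smooth near [x] is irrelevant. *)
Definition tangent_at (x : M) (v : (M -> R) -> R) : Prop :=
  [/\ forall f g, smooth_near x f -> (\forall y \near x, f y = g y) -> v f = v g,
      forall a f g, smooth_near x f -> smooth_near x g ->
        v (fun y => a * f y + g y) = a * v f + v g &
      forall f g, smooth_near x f -> smooth_near x g ->
        v (fun y => f y * g y) = v f * g x + f x * v g].

Definition vfield := M -> (M -> R) -> R.

Definition vfield_on (V : set M) (X : vfield) : Prop :=
  (forall x, V x -> tangent_at x (X x)) /\
  (forall (W : set M) f, open W -> W `<=` V -> smooth_on W f ->
     smooth_on W (fun x => X x f)).

Definition vf_eq (V : set M) (X Y : vfield) : Prop :=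
  forall x f, V x -> smooth_near x f -> X x f = Y x f.

Definition vf_zero : vfield := fun _ _ => 0.
Definition vf_add (X Y : vfield) : vfield := fun x f => X x f + Y x f.
Definition vf_scale (g : M -> R) (X : vfield) : vfield := fun x f => g x * X x f.
Definition vf_bracket (X Y : vfield) : vfield :=
  fun x f => X x (fun y => Y y f) - Y x (fun y => X y f).

(* [F V] is the set of sections over the open set [V]. *)
Definition generates (F : set M -> set vfield) (U : set M) (k : nat)
    (X : 'I_k -> vfield) : Prop :=
  (forall i, F U (X i)) /\
  (forall (V : set M) Y, open V -> V `<=` U -> F V Y ->
     locally_on V (fun W => exists g : 'I_k -> M -> R,
       (forall i, smooth_on W (g i)) /\
       vf_eq W Y (fun x f => \sum_(i < k) g i x * X i x f))).

Record singular_foliation := SingularFoliation {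
  fol :> set M -> set vfield;
  fol_vfield : forall V X, open V -> fol V X -> vfield_on V X;
  (* subsheaf *)
  fol_ext : forall V X Y, open V -> fol V X -> vf_eq V X Y -> fol V Y;
  fol_res : forall V W X, open V -> open W -> W `<=` V -> fol V X -> fol W X;
  fol_glue : forall V X, open V -> locally_on V (fun W => fol W X) -> fol V X;
  (* of O-modules *)
  fol0 : forall V, open V -> fol V vf_zero;
  folD : forall V X Y, open V -> fol V X -> fol V Y -> fol V (vf_add X Y);
  folZ : forall V g X, open V -> smooth_on V g -> fol V X -> fol V (vf_scale g X);
  (* involutive and locally finitely generated *)
  fol_bracket : forall V X Y,
    open V -> fol V X -> fol V Y -> fol V (vf_bracket X Y);
  fol_fingen : locally_on setT (fun W => exists k (X : 'I_k -> vfield),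
    generates fol W X) }.

Definition generated_near (F : set M -> set vfield) (m : M) (k : nat) : Prop :=
  exists U (X : 'I_k -> vfield), [/\ open U, U m & generates F U X].

Definition foliation_rank (F : set M -> set vfield) (m : M) (r : nat) : Prop :=
  generated_near F m r /\ (forall k, generated_near F m k -> (r <= k)%N).

End SmoothFunctions.

Section Bundles.
Variables (R : realType) (M : manifold R) (U : set M).

(* A vector bundle over the open set [U]: fibres together with an atlas of
   local frames with smooth transition functions.  Fibres outside [U] are
   irrelevant. *)
Record vbundle := VBundle {
  vrank : nat;
  vfib :> M -> vectType R;
  vframes : set (set M * (forall x, vrank.-tuple (vfib x)));
  vframes_open : forall e, vframes e -> open e.1 /\ e.1 `<=` U;
  vframes_basis : forall e x, vframes e -> e.1 x -> basis_of fullv (e.2 x);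
  vframes_cover : forall x, U x -> exists2 e, vframes e & e.1 x;
  vframes_smooth : forall e e' (i j : 'I_vrank), vframes e -> vframes e' ->
    smooth_on (e.1 `&` e'.1) (fun x => coord (e.2 x) i (tnth (e'.2 x) j)) }.

Definition section (E : vbundle) := forall x : M, E x.

Definition smooth_section (E : vbundle) (V : set M) (s : section E) : Prop :=
  forall e (i : 'I_(vrank E)), vframes e ->
    smooth_on (V `&` e.1) (fun x => coord (e.2 x) i (s x)).

(* Vector bundle morphisms over the identity from E to E', and to TM. *)
Record vbmorphism (E E' : vbundle) := VBMorphism {
  vbm :> forall x : M, 'Hom(E x, E' x);
  vbm_smooth : forall (V : set M) (s : section E), open V -> V `<=` U ->
    smooth_section V s ->
    smooth_section (E := E') V (fun x => vbm x (s x)) }.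

Record anchor (E : vbundle) := Anchor {
  anc :> forall x : M, E x -> (M -> R) -> R;
  anc_linear : forall x a (u v : E x) f, smooth_near x f ->
    anc (a *: u + v) f = a * anc u f + anc v f;
  anc_tangent : forall x (u : E x), U x -> tangent_at x (anc u);
  anc_smooth : forall (V : set M) (s : section E), open V -> V `<=` U ->
    smooth_section V s -> vfield_on V (fun x => anc (s x)) }.

Definition anchor_image (E : vbundle) (rho : anchor E) (s : section E) :
  vfield M := fun x => rho x (s x).

(* The image of the sheaf morphism rho : Gamma(E) -> X_U is F|_U. *)
Definition anchor_onto (F : singular_foliation M) (E : vbundle)
    (rho : anchor E) : Prop :=
  (forall (V : set M) (s : section E), open V -> V `<=` U ->
     smooth_section V s -> F V (anchor_image rho s)) /\
  (forall (V : set M) X, open V -> V `<=` U -> F V X ->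
     locally_on V (fun W => exists s : section E,
       smooth_section W s /\ vf_eq W X (anchor_image rho s))).

Section AnchorKernel.
Variables (E : vbundle) (rho : anchor E) (m : M).

Definition anchor_ker : pred (E m) :=
  fun u => `[< forall f, smooth_near m f -> rho m u f = 0 >].

Lemma anchor_ker_submod : submod_closed anchor_ker.
Proof.
split; first by apply/asboolP => f sf;
  have := anc_linear rho (-1) (0 : E m) 0 sf;
  rewrite scaler0 addr0 mulN1r addNr.
move=> a u v /asboolP hu /asboolP hv; apply/asboolP => f sf.
by rewrite anc_linear // hu // hv // mulr0 addr0.
Qed.

HB.instance Definition _ :=
  GRing.isSubmodClosed.Build R (E m) anchor_ker anchor_ker_submod.

Record ker_at := KerAt { ker_val : E m; _ : anchor_ker ker_val }.

HB.instance Definition _ := [isSub for ker_val].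
HB.instance Definition _ := [Choice of ker_at by <:].
HB.instance Definition _ := [SubChoice_isSubLmodule of ker_at by <:].

End AnchorKernel.

(* The bracket is one on the sheaf of sections of A. *)
Record lie_algebroid := LieAlgebroid {
  la_bundle : vbundle;
  la_anchor : anchor la_bundle;
  la_br : section la_bundle -> section la_bundle -> section la_bundle;
  la_smooth : forall (V : set M) s t, open V -> V `<=` U ->
    smooth_section V s -> smooth_section V t -> smooth_section V (la_br s t);
  la_local : forall (V : set M) s s' t t', open V -> V `<=` U ->
    smooth_section V s -> smooth_section V s' ->
    smooth_section V t -> smooth_section V t' ->
    (forall x, V x -> s x = s' x) -> (forall x, V x -> t x = t' x) ->
    forall x, V x -> la_br s t x = la_br s' t' x;
  la_linear : forall (V : set M) (a : R) s s' t, open V -> V `<=` U ->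
    smooth_section V s -> smooth_section V s' -> smooth_section V t ->
    forall x, V x ->
      la_br (fun y => a *: s y + s' y) t x = a *: la_br s t x + la_br s' t x;
  la_anti : forall (V : set M) s t, open V -> V `<=` U ->
    smooth_section V s -> smooth_section V t ->
    forall x, V x -> la_br s t x = - la_br t s x;
  la_jacobi : forall (V : set M) s t u, open V -> V `<=` U ->
    smooth_section V s -> smooth_section V t -> smooth_section V u ->
    forall x, V x ->
      la_br s (la_br t u) x + la_br t (la_br u s) x + la_br u (la_br s t) x = 0;
  la_leibniz : forall (V : set M) f s t, open V -> V `<=` U -> smooth_on V f ->
    smooth_section V s -> smooth_section V t ->
    forall x, V x ->
      la_br s (fun y => f y *: t y) x =
      f x *: la_br s t x + la_anchor x (s x) f *: t x }.

End Bundles.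

Arguments smooth_section {R M U} E V s.
Arguments anchor_ker {R M U E} rho m.
Arguments ker_at {R M U E} rho m.

Definition tupd (T : Type) (n : nat) (xs : n.-tuple T) (i : 'I_n) (a : T) :
  n.-tuple T := [tuple (if j == i then a else tnth xs j) | j < n].

Section GradedBundles.
Variables (R : realType) (M : manifold R) (U : set M).

(* [E k] stands for E_{-k}, k >= 1; in the structures below [E 0] is required
   to be the zero bundle. *)
Variable E : nat -> vbundle U.

(* Not necessarily homogeneous sections of the direct sum of the E_{-k}. *)
Definition gsection := forall (k : nat) (x : M), E k x.

(* [s] is a section over V, homogeneous of degree -k. *)
Definition homog (k : nat) (V : set M) (s : gsection) : Prop :=
  (forall j x, j != k -> V x -> s j x = 0) /\ smooth_section (E k) V (s k).

Definition gs_eq (V : set M) (s t : gsection) : Prop :=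
  forall j x, V x -> s j x = t j x.

Definition gs_lin (f : M -> R) (s t : gsection) : gsection :=
  fun j x => f x *: s j x + t j x.

Definition homog_tuple n (ks : n.-tuple nat) (V : set M)
    (xs : n.-tuple gsection) : Prop :=
  forall i, homog (tnth ks i) V (tnth xs i).

Definition permt (T : Type) n (xs : n.-tuple T) (s : 'S_n) : n.-tuple T :=
  [tuple tnth xs (s i) | i < n].

(* Koszul sign: x_{s 0} . ... . x_{s (n-1)} = koszul ks s (x_0 . ... . x_{n-1})
   in the graded symmetric algebra, for x_i of degree -(ks_i). *)
Definition koszul n (ks : n.-tuple nat) (s : 'S_n) : R :=
  \prod_(i < n) \prod_(j < n | (i < j)%N && (s j < s i)%N)
    (-1) ^+ (tnth ks (s i) * tnth ks (s j)).

Definition unshuffle n (i : nat) (s : 'S_n) : bool :=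
  [forall a : 'I_n, forall b : 'I_n,
    ((a < b)%N && ((b < i)%N || (i <= a)%N)) ==> (s a < s b)%N].

(* Lie oo-algebroid structure.  All brackets, of all arities n >= 1, are given
   by [br], applied to the sequence of the n arguments; its value on the empty
   sequence is irrelevant. *)
Record Linfty_algebroid (rho : anchor (E 1)) (br : seq gsection -> gsection) :
    Prop := LinftyAlgebroid {
  Li_zero : vrank (E 0) = 0%N;
  Li_degree : forall (V : set M) n (ks : n.-tuple nat) (xs : n.-tuple gsection),
    open V -> V `<=` U -> (0 < n)%N -> homog_tuple ks V xs ->
    homog (sumn ks).-1 V (br xs);
  Li_local : forall (V : set M) n (ks : n.-tuple nat)
      (xs ys : n.-tuple gsection),
    open V -> V `<=` U -> (0 < n)%N ->
    homog_tuple ks V xs -> homog_tuple ks V ys ->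
    (forall i, gs_eq V (tnth xs i) (tnth ys i)) -> gs_eq V (br xs) (br ys);
  Li_symmetric : forall (V : set M) n (ks : n.-tuple nat)
      (xs : n.-tuple gsection) (s : 'S_n),
    open V -> V `<=` U -> (0 < n)%N -> homog_tuple ks V xs ->
    forall j x, V x -> br (permt xs s) j x = koszul ks s *: br xs j x;
  Li_jacobi : forall (V : set M) n (ks : n.-tuple nat)
      (xs : n.-tuple gsection),
    open V -> V `<=` U -> (0 < n)%N -> homog_tuple ks V xs ->
    forall j x, V x ->
      \sum_(1 <= i < n.+1) \sum_(s : 'S_n | unshuffle i s)
        koszul ks s *:
          br (br (take i (permt xs s)) :: drop i (permt xs s)) j x = 0;
  Li_multilinear : forall (V : set M) n (ks : n.-tuple nat)
      (xs : n.-tuple gsection) (i : 'I_n) (f : M -> R) (a b : gsection),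
    open V -> V `<=` U -> n != 2%N -> homog_tuple ks V xs -> smooth_on V f ->
    homog (tnth ks i) V a -> homog (tnth ks i) V b ->
    forall j x, V x ->
      br (tupd xs i (gs_lin f a b)) j x =
      f x *: br (tupd xs i a) j x + br (tupd xs i b) j x;
  Li_leibniz : forall (V : set M) (k l : nat) (f : M -> R)
      (y a b : gsection),
    open V -> V `<=` U -> smooth_on V f ->
    homog k V y -> homog l V a -> homog l V b ->
    forall j x, V x ->
      br [:: y; gs_lin f a b] j x =
      f x *: br [:: y; a] j x + br [:: y; b] j x +
      (if k == 1%N then rho x (y 1%N x) f *: a j x else 0) }.

(* [d k] stands for d^{(k+1)} : E_{-(k+1)} -> E_{-k}; [d 0] is zero. *)
Record is_geometric_resolution (F : singular_foliation M)
    (d : forall k, vbmorphism (E k.+1) (E k)) (rho : anchor (E 1)) : Prop :=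
  IsGeometricResolution {
  gr_zero : vrank (E 0) = 0%N;
  gr_onto : anchor_onto F rho;
  gr_exact1 : forall (V : set M) (s : section (E 1)), open V -> V `<=` U ->
    smooth_section (E 1) V s ->
    vf_eq V (anchor_image rho s) (@vf_zero R M) <->
    locally_on V (fun W => exists t : section (E 2),
      smooth_section (E 2) W t /\ (forall x, W x -> s x = d 1%N x (t x)));
  gr_exact : forall k (V : set M) (s : section (E k.+2)),
    open V -> V `<=` U -> smooth_section (E k.+2) V s ->
    (forall x, V x -> d k.+1 x (s x) = 0) <->
    locally_on V (fun W => exists t : section (E k.+3),
      smooth_section (E k.+3) W t /\ (forall x, W x -> s x = d k.+2 x (t x))) }.

End GradedBundles.

Record geometric_resolution (R : realType) (M : manifold R) (U : set M)
    (F : singular_foliation M) := GeometricResolution {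
  gr_bundle : nat -> vbundle U;
  gr_d : forall k, vbmorphism (gr_bundle k.+1) (gr_bundle k);
  gr_anchor : anchor (gr_bundle 1);
  gr_resolution : is_geometric_resolution F gr_d gr_anchor }.

Definition finite_length (R : realType) (M : manifold R) (U : set M)
    (F : singular_foliation M) (G : geometric_resolution U F) : Prop :=
  exists N, forall k, (N <= k)%N -> vrank (gr_bundle G k) = 0%N.

Definition minimal_at (R : realType) (M : manifold R) (U : set M)
    (F : singular_foliation M) (G : geometric_resolution U F) (m : M) : Prop :=
  forall k, (0 < k)%N -> gr_d G k m = 0.

(* A Lie oo-algebroid over [U] whose linear part is a geometric resolution
   of F|_U. *)
Record universal_Linfty (R : realType) (M : manifold R) (U : set M)
    (F : singular_foliation M) := UniversalLinfty {
  uL_res :> geometric_resolution U F;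
  uL_br : seq (gsection (gr_bundle uL_res)) -> gsection (gr_bundle uL_res);
  uL_Linfty : Linfty_algebroid (gr_anchor uL_res) uL_br;
  uL_linear : forall k (V : set M) (s : gsection (gr_bundle uL_res)),
    open V -> V `<=` U -> homog k.+1 V s ->
    forall x, V x -> uL_br [:: s] k x = gr_d uL_res k x (s k.+1 x) }.

Arguments uL_br {R M U F} _ _.

Section ChevalleyEilenberg.
Variables (R : realType) (g V : lmodType R).
Variables (br : g -> g -> g) (act : g -> V -> V).

Definition CE_cochain n (w : n.-tuple g -> V) : Prop :=
  (forall (xs : n.-tuple g) i a (u v : g),
     w (tupd xs i (a *: u + v)) = a *: w (tupd xs i u) + w (tupd xs i v)) /\
  (forall (xs : n.-tuple g) (i j : 'I_n),
     i != j -> tnth xs i = tnth xs j -> w xs = 0).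

(* In the second sum the pair of removed entries is (lift j i, j), and
   lift j i = i since i < j. *)
Definition CE_diff n (w : n.+1.-tuple g -> V) (xs : n.+2.-tuple g) : V :=
  \sum_(i < n.+2) (-1) ^+ i *:
    act (tnth xs i) (w [tuple tnth xs (lift i k) | k < n.+1]) +
  \sum_(j < n.+2) \sum_(i < n.+1 | (i < j)%N) (-1) ^+ (i + j) *:
    w [tuple of br (tnth xs (lift j i)) (tnth xs j) ::
         [tuple tnth xs (lift j (lift i k)) | k < n]].

Definition CE_cocycle n (w : n.+1.-tuple g -> V) : Prop :=
  CE_cochain w /\ forall xs, CE_diff w xs = 0.

(* Cohomology classes, as cosets of the coboundaries in the cocycles. *)
Definition CE_class n (w : n.+2.-tuple g -> V) : set (n.+2.-tuple g -> V) :=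
  [set w' | CE_cocycle w' /\
    exists2 h : n.+1.-tuple g -> V,
      CE_cochain h & forall xs, w' xs - w xs = CE_diff h xs].

End ChevalleyEilenberg.

Section NMRLA.
Variables (R : realType) (M : manifold R) (U : set M).
Variables (F : singular_foliation M) (W : universal_Linfty U F) (m : M).

Local Notation E := (gr_bundle W).

Definition H1 : lmodType R := ker_at (gr_anchor W) m.
Definition H2 : lmodType R := E 2 m.

Definition extends k (u : E k m) (s : gsection E) : Prop :=
  exists V : set M, [/\ open V, V m, V `<=` U, homog k V s & s k m = u].

(* Each of the following sets, for (W, m) minimal at m, is a singleton: its
   element is obtained by extending the arguments to local sections, taking
   their bracket and evaluating at m; [xget 0] extracts it. *)
Definition H1_bracket (u v : H1) : H1 :=
  xget 0 [set w : H1 | exists x y,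
    [/\ extends (ker_val u) x, extends (ker_val v) y &
        uL_br W [:: x; y] 1%N m = ker_val w]].

Definition H2_action (u : H1) (e : H2) : H2 :=
  xget 0 [set w : H2 | exists x (y : gsection E),
    [/\ extends (ker_val u) x, extends (k := 2) e y &
        uL_br W [:: x; y] 2%N m = w]].

Definition NMRLA_cocycle (us : 3.-tuple H1) : H2 :=
  xget 0 [set w : H2 | exists xs : 3.-tuple (gsection E),
    (forall i, extends (ker_val (tnth us i)) (tnth xs i)) /\
    uL_br W xs 2%N m = w].

Definition NMRLA_class : set (3.-tuple H1 -> H2) :=
  CE_class H1_bracket H2_action NMRLA_cocycle.

Definition NMRLA_class_vanishes : Prop :=
  NMRLA_class = CE_class H1_bracket H2_action (fun _ : 3.-tuple H1 => 0).

End NMRLA.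

(* Main.v *)
Require Import Defs.
From HB Require Import structures.
From mathcomp Require Import all_boot all_order all_algebra all_fingroup.
From mathcomp Require Import all_classical all_reals all_analysis.
From mathcomp Require Import lra.

Set Implicit Arguments.
Unset Strict Implicit.
Unset Printing Implicit Defensive.

Import Order.TTheory GRing.Theory Num.Theory.
Import numFieldNormedType.Exports.

Local Open Scope classical_set_scope.
Local Open Scope ring_scope.

(* Suppose such a Lie algebroid A exists, with local frame a_i near m.  Lift it
   through the anchors to sections s_i of E_{-1} with rho(s_i) = rho_A(a_i).
   Since d^{(2)} vanishes at m, lifting a frame of E_{-1} back to A shows that
   the s_i(m) span E_{-1}|_m, and as A has the minimal rank they form a basis.
   The defect of a_i |-> s_i to preserve brackets lies in the kernel of rho,
   hence equals d K_ij for some sections K_ij of E_{-2}.  Comparing the Jacobi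
   identities of A and of E shows that the ternary bracket and the
   Chevalley-Eilenberg differential of K differ by a d-closed section of E_{-2},
   that is locally by a section in the image of d^{(3)}, which vanishes at m.
   So the NMRLA cocycle is the coboundary of K|_m. *)

(** * Smooth functions *)

(** Neither structure has bracket-preserving anchors among its axioms; on both sides this follows
    from the Jacobi identity and the Leibniz rule, and [almost_lie] lets one argument serve for
    both. The assignment a_i |-> s_i extends over functions to a bundle map phi with rho o phi =
    rho_A, but the K_ij are attached to pairs of frame sections only. Elements of H^{-1} are
    therefore extended with constant coefficients in the s_i; the only variable coefficients are the
    structure functions of A, and their derivatives cancel because phi respects the anchors. As the
    s_i(m) form a basis of the whole fibre E_{-1}|_m, the K_ij(m) define a bilinear map on it, whose
    restriction to ker rho_m is the cochain. Minimality at m is also what identifies the bracket of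
    H^{-1} with the structure constants of A at m, since d K_ij vanishes there. The operations at m
    are extracted by [xget] from arbitrary extensions, so each must be shown to depend only on
    values at m; [tensorial_at] isolates the reason. *)

Section Smoothness.
Variables (R : realType) (n : nat).
Implicit Types (O : set 'rV[R]_n) (f g : 'rV[R]_n -> R).

Lemma Ck_sub k O O' f : O' `<=` O -> Ck k O f -> Ck k O' f.
Proof.
elim: k f => [|k IHk] f sO [cf df]; first by split=> // x /sO /cf.
split=> [x /sO /cf //|i].
by have [di ci] := df i; split=> [x /sO /di //|]; exact: IHk.
Qed.

(** Openness turns equality on [O] into equality near each point, which is all that limits and
    derivatives see. *)
Lemma Ck_ext k O f g : open O -> (forall x, O x -> f x = g x) ->
  Ck k O f -> Ck k O g.
Proof.
move=> oO; elim: k f g => [|k IHk] f g fg [cf df].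
  split=> // x Ox.
  have fgx : {near x, f =1 g} by near=> y; apply: fg; near: y; exact: open_nbhs_nbhs.
  rewrite /prop_for /continuous_at -(fg x Ox).
  by apply: cvg_trans (cf x Ox); apply: near_eq_cvg fgx.
have fgx x : O x -> {near x, f =1 g}.
  by move=> Ox; near=> y; apply: fg; near: y; exact: open_nbhs_nbhs.
split=> [x Ox|i].
  rewrite /prop_for /continuous_at -(fg x Ox).
  by apply: cvg_trans (cf x Ox); apply: near_eq_cvg (fgx x Ox).
have [di ci] := df i; split=> [x Ox|].
  exact: near_eq_derivable (fgx x Ox) (di x Ox).
apply: IHk ci => x Ox; exact: near_eq_derive (fgx x Ox).
Unshelve. all: by end_near. Qed.

Lemma Ck_le k O f : Ck k.+1 O f -> Ck k O f.
Proof.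
elim: k f => [|k IHk] f [cf df]; split=> // i.
by have [di ci] := df i; split=> //; exact: IHk.
Qed.

Lemma Ck_cst k O (a : R) : Ck k O (fun=> a).
Proof.
elim: k a => [|k IHk] a; first by split=> // x _; exact: cst_continuous.
split=> [x _|i]; first exact: cst_continuous.
split=> [x _|]; first exact: derivable_cst.
suff -> : (fun x : 'rV[R]_n => 'D_(delta_mx 0 i) (fun=> a) x) = (fun=> 0) by exact: IHk.
by apply: funext => x; exact: derive_cst.
Qed.

Lemma Ck_add k O f g : open O -> Ck k O f -> Ck k O g ->
  Ck k O (fun x => f x + g x).
Proof.
move=> oO; elim: k f g => [|k IHk] f g [cf df] [cg dg].
  by split=> // x Ox; exact: (cvgD (cf x Ox) (cg x Ox)).
split=> [x Ox|i]; first by exact: (cvgD (cf x Ox) (cg x Ox)).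
have [dfi cfi] := df i; have [dgi cgi] := dg i; split=> [x Ox|].
  exact: derivableD (dfi x Ox) (dgi x Ox).
apply: Ck_ext oO _ (IHk _ _ cfi cgi) => x Ox.
by rewrite -deriveD; [|exact: dfi|exact: dgi].
Qed.

Lemma Ck_mul k O f g : open O -> Ck k O f -> Ck k O g ->
  Ck k O (fun x => f x * g x).
Proof.
move=> oO; elim: k f g => [|k IHk] f g Cf Cg.
  split=> // x Ox; exact: (cvgM (Cf.1 x Ox) (Cg.1 x Ox)).
(* The product rule multiplies each factor by a derivative of the other, so the induction hypothesis
   needs the factors themselves one order lower. *)
have [Cf' Cg'] := (Ck_le Cf, Ck_le Cg).
move: Cf Cg => [cf df] [cg dg]; split=> [x Ox|i].
  exact: (cvgM (cf x Ox) (cg x Ox)).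
have [dfi cfi] := df i; have [dgi cgi] := dg i; split=> [x Ox|].
  exact: derivableM (dfi x Ox) (dgi x Ox).
apply: Ck_ext oO _ (Ck_add oO (IHk _ _ Cf' cgi) (IHk _ _ Cg' cfi)) => x Ox.
by rewrite deriveM; [|exact: dfi|exact: dgi].
Qed.

End Smoothness.

Section SmoothOn.
Variables (R : realType) (M : manifold R).
Implicit Types (V W : set M) (f g : M -> R).

(** Within the open image of the chart, this set is the preimage of [V] under the continuous map
    [cinv c]. *)
Lemma chart_image_open (c : chart R M (mdim M)) V : open V ->
  open (cmap c @` (V `&` cdom c)).
Proof.
move=> oV; rewrite openE => _ [x [Vx cx] <-].
rewrite /interior.
have ix : (cmap c @` cdom c) (cmap c x) by exists x.
have : \forall y \near cmap c x, (cmap c @` cdom c) y.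
  by apply: open_nbhs_nbhs; split=> //; exact: cimg_open.
have cK : cinv c (cmap c x) = x by rewrite cmapK ?inE.
have : \forall y \near cmap c x, V (cinv c y).
  have := cinv_cont ix; rewrite /prop_for /continuous_at cK; apply.
  exact: open_nbhs_nbhs.
apply: filterS2 => _ /[swap] -[z cz <-].
by rewrite cmapK ?inE // => Vz; exists z.
Qed.

Lemma smooth_on_sub V W f : W `<=` V -> smooth_on V f -> smooth_on W f.
Proof.
move=> sWV sf c ac k; apply: Ck_sub (sf c ac k).
by apply: image_subset => x [/sWV Vx cx].
Qed.

Lemma smooth_on_ext V f g : open V -> (forall x, V x -> f x = g x) ->
  smooth_on V f -> smooth_on V g.
Proof.
move=> oV fg sf c ac k; apply: Ck_ext (sf c ac k); first exact: chart_image_open.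
by move=> _ [x [Vx cx] <-] /=; rewrite cmapK ?inE // fg.
Qed.

Lemma smooth_on_cst V (a : R) : smooth_on V (fun=> a).
Proof. move=> c ac k; exact: Ck_cst. Qed.

Lemma smooth_onD V f g : open V -> smooth_on V f -> smooth_on V g ->
  smooth_on V (fun x => f x + g x).
Proof.
by move=> oV sf sg c ac k; apply: Ck_add; [exact: chart_image_open|exact: sf|exact: sg].
Qed.

Lemma smooth_onM V f g : open V -> smooth_on V f -> smooth_on V g ->
  smooth_on V (fun x => f x * g x).
Proof.
by move=> oV sf sg c ac k; apply: Ck_mul; [exact: chart_image_open|exact: sf|exact: sg].
Qed.

Lemma smooth_on_near V f x : open V -> V x -> smooth_on V f -> smooth_near x f.
Proof. by move=> oV Vx sf; exists V. Qed.

End SmoothOn.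

(** * Sections of vector bundles *)

Section Sections.
Variables (R : realType) (M : manifold R) (U : set M) (E : vbundle U).
Implicit Types (V W : set M) (s t : section E) (f : M -> R).

Lemma section_ext s t : (forall x, s x = t x) -> s = t.
Proof. exact: functional_extensionality_dep. Qed.

Lemma smooth_section_sub V W s : W `<=` V ->
  smooth_section E V s -> smooth_section E W s.
Proof.
move=> sWV ss e i fe; apply: smooth_on_sub (ss e i fe) => x [Wx ex].
by split=> //; exact: sWV.
Qed.

Lemma smooth_section_ext V s t : open V -> (forall x, V x -> s x = t x) ->
  smooth_section E V s -> smooth_section E V t.
Proof.
move=> oV st ss e i fe; apply: smooth_on_ext (ss e i fe).
  by apply: openI => //; have [] := vframes_open fe.
by move=> x [Vx _] /=; rewrite st.
Qed.

Lemma smooth_section0 V : smooth_section E V (fun=> 0).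
Proof.
move=> e i fe; rewrite (_ : (fun=> _) = fun=> 0); first exact: smooth_on_cst.
by apply: funext => x; rewrite linear0.
Qed.

Lemma smooth_section_lin V f s t : open V -> smooth_on V f ->
  smooth_section E V s -> smooth_section E V t ->
  smooth_section E V (fun x => f x *: s x + t x).
Proof.
move=> oV sf ss st e i fe.
have oVe : open (V `&` e.1) by apply: openI => //; have [] := vframes_open fe.
rewrite (_ : (fun=> _) = fun x => f x * coord (e.2 x) i (s x) + coord (e.2 x) i (t x)); last first.
  by apply: funext => x; rewrite linearP.
apply: smooth_onD (st e i fe) => //; apply: smooth_onM (ss e i fe) => //.
by apply: smooth_on_sub sf => x [].
Qed.

Lemma smooth_sectionZ V f s : open V -> smooth_on V f ->
  smooth_section E V s -> smooth_section E V (fun x => f x *: s x).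
Proof.
move=> oV sf ss; rewrite (_ : (fun=> _) = fun x => f x *: s x + 0).
  by apply: smooth_section_lin => //; exact: smooth_section0.
by apply: section_ext => x; rewrite addr0.
Qed.

Lemma smooth_sectionZc V (a : R) s : open V ->
  smooth_section E V s -> smooth_section E V (fun x => a *: s x).
Proof. move=> oV ss; exact: (smooth_sectionZ oV (smooth_on_cst V a) ss). Qed.

Lemma smooth_sectionN V s : open V ->
  smooth_section E V s -> smooth_section E V (fun x => - s x).
Proof.
move=> oV ss; rewrite (_ : (fun=> _) = fun x => -1 *: s x).
  exact: smooth_sectionZc.
by apply: section_ext => x; rewrite scaleN1r.
Qed.

Lemma smooth_sectionD V s t : open V ->
  smooth_section E V s -> smooth_section E V t ->
  smooth_section E V (fun x => s x + t x).
Proof.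
move=> oV ss st; rewrite (_ : (fun=> _) = fun x => 1 *: s x + t x).
  exact: (smooth_section_lin oV (smooth_on_cst V 1)).
by apply: section_ext => x; rewrite scale1r.
Qed.

Lemma smooth_section_sum V (I : Type) (r : seq I) (s : I -> section E) :
  open V -> (forall i, smooth_section E V (s i)) ->
  smooth_section E V (fun x => \sum_(i <- r) s i x).
Proof.
move=> oV ss; elim: r => [|i r IHr].
  rewrite (_ : (fun=> _) = fun=> 0); first exact: smooth_section0.
  by apply: section_ext => x; rewrite big_nil.
rewrite (_ : (fun=> _) = fun x => s i x + \sum_(i <- r) s i x).
  exact: smooth_sectionD.
by apply: section_ext => x; rewrite big_cons.
Qed.

Lemma smooth_section_frame e i : vframes (v := E) e ->
  smooth_section E e.1 (fun x => tnth (e.2 x) i).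
Proof. by move=> fe e' j fe'; rewrite setIC; exact: vframes_smooth. Qed.

Lemma smooth_coord V e i s : vframes (v := E) e -> V `<=` e.1 ->
  smooth_section E V s -> smooth_on V (fun x => coord (e.2 x) i (s x)).
Proof.
by move=> fe sVe ss; have := ss e i fe; rewrite (setIidl sVe).
Qed.

Lemma frame_expand e x (u : E x) : vframes (v := E) e -> e.1 x ->
  u = \sum_(i < vrank E) coord (e.2 x) i u *: tnth (e.2 x) i.
Proof.
move=> fe ex; rewrite {1}(coord_basis (vframes_basis fe ex) (memvf u)).
by apply: eq_bigr => i _; rewrite (tnth_nth 0).
Qed.

(** Meant for brackets evaluated at a point, which are additive on smooth sections only; hence the
    induction keeps every partial sum smooth. *)
Lemma additive_sum (T : zmodType) V (L : section E -> T) : open V ->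
  (forall s t, smooth_section E V s -> smooth_section E V t ->
     L (fun x => s x + t x) = L s + L t) ->
  forall (I : Type) (r : seq I) (s : I -> section E),
    (forall i, smooth_section E V (s i)) ->
    L (fun x => \sum_(i <- r) s i x) = \sum_(i <- r) L (s i).
Proof.
move=> oV LD I r s ss.
have L0 : L (fun x => 0 : E x) = 0.
  have := LD _ _ (@smooth_section0 V) (@smooth_section0 V).
  rewrite (_ : (fun x => 0 + 0) = (fun x => 0 : E x)); last first.
    by apply: section_ext => x; rewrite addr0.
  by move=> /eqP; rewrite -[X in X == _]addr0 eq_sym (inj_eq (addrI _)) => /eqP.
elim: r => [|i r IHr].
  rewrite big_nil -[RHS]L0; congr L.
  by apply: section_ext => x; rewrite big_nil.
rewrite big_cons -IHr -LD //; last exact: smooth_section_sum.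
by congr L; apply: section_ext => x; rewrite big_cons.
Qed.

(** Locality and linearity over functions, the latter with the coefficient evaluated at [m]: just
    enough for [L] to factor through the fibre at [m]. *)
Definition tensorial_at (m : M) (T : lmodType R) (L : section E -> T) : Prop :=
  (forall V s t, open V -> V `<=` U -> V m ->
     smooth_section E V s -> smooth_section E V t ->
     (forall x, V x -> s x = t x) -> L s = L t) /\
  (forall V f s t, open V -> V `<=` U -> V m -> smooth_on V f ->
     smooth_section E V s -> smooth_section E V t ->
     L (fun x => f x *: s x + t x) = f m *: L s + L t).

Lemma tensorial_at_eq m (T : lmodType R) (L : section E -> T) V s t :
  tensorial_at m L -> open V -> V `<=` U -> V m ->
  smooth_section E V s -> smooth_section E V t -> s m = t m -> L s = L t.
Proof.
move=> [Lloc Llin] oV sVU Vm ss st stm.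
have [e fe em] := vframes_cover E (sVU m Vm).
have [oe seU] := vframes_open fe.
pose W := V `&` e.1.
have oW : open W by exact: openI.
have sWU : W `<=` U by move=> x [/sVU].
have sWe : W `<=` e.1 by move=> x [].
have Wm : W m by [].
have se i : smooth_section E W (fun x => tnth (e.2 x) i).
  exact: smooth_section_sub sWe (smooth_section_frame i fe).
(* Expanding [q] in a local frame, [L] sees the coefficient functions only through their values at
   [m]. *)
suff LE q : smooth_section E W q ->
    L q = \sum_(i < vrank E) coord (e.2 m) i (q m) *: L (fun x => tnth (e.2 x) i).
  have sWV : W `<=` V by move=> x [].
  by rewrite (LE s (smooth_section_sub sWV ss)) (LE t (smooth_section_sub sWV st)) stm.
move=> sq.
have sc i : smooth_on W (fun x => coord (e.2 x) i (q x)) by exact: smooth_coord.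
have LD s' t' : smooth_section E W s' -> smooth_section E W t' ->
    L (fun x => s' x + t' x) = L s' + L t'.
  move=> ss' st'; have := Llin W (fun=> 1) s' t' oW sWU Wm (smooth_on_cst W 1) ss' st'.
  rewrite scale1r => <-; congr L.
  by apply: section_ext => x; rewrite scale1r.
rewrite (Lloc W q (fun x => \sum_(i < vrank E) coord (e.2 x) i (q x) *: tnth (e.2 x) i)) //.
- rewrite (additive_sum oW LD) => [|i]; last exact: smooth_sectionZ.
  apply: eq_bigr => i _.
  have L0 : L (fun x => 0 : E x) = 0.
    have := additive_sum oW LD [::] (s := fun (_ : nat) => fun x => 0 : E x).
    rewrite big_nil => <- => [|j]; last exact: smooth_section0.
    by congr L; apply: section_ext => x; rewrite big_nil.
  rewrite -[RHS]addr0 -L0 -(Llin W _ _ _ oW sWU Wm (sc i) (se i)); last exact: smooth_section0.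
  by congr L; apply: section_ext => x; rewrite addr0.
- by apply: smooth_section_sum => // i; exact: smooth_sectionZ.
- by move=> x [_ ex]; exact: frame_expand.
Qed.

End Sections.

Section Anchors.
Variables (R : realType) (M : manifold R) (U : set M) (E : vbundle U).
Variable rho : anchor E.

Lemma anc0 x f : smooth_near x f -> rho x 0 f = 0.
Proof.
move=> sf; have := anc_linear rho (-1) (0 : E x) 0 sf.
by rewrite scaler0 addr0 mulN1r addNr.
Qed.

Lemma ancD x (u v : E x) f : smooth_near x f ->
  rho x (u + v) f = rho x u f + rho x v f.
Proof. by move=> sf; have := anc_linear rho 1 u v sf; rewrite scale1r mul1r. Qed.

Lemma ancZ x a (u : E x) f : smooth_near x f -> rho x (a *: u) f = a * rho x u f.
Proof.
by move=> sf; have := anc_linear rho a u 0 sf; rewrite addr0 anc0 // addr0.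
Qed.

Lemma ancN x (u : E x) f : smooth_near x f -> rho x (- u) f = - rho x u f.
Proof. by move=> sf; rewrite -scaleN1r ancZ // mulN1r. Qed.

Lemma anc_sum x (I : Type) (r : seq I) (u : I -> E x) f : smooth_near x f ->
  rho x (\sum_(i <- r) u i) f = \sum_(i <- r) rho x (u i) f.
Proof.
move=> sf; elim: r => [|i r IHr]; first by rewrite !big_nil anc0.
by rewrite !big_cons ancD // IHr.
Qed.

Lemma smooth_on_anc V (s : section E) f : open V -> V `<=` U ->
  smooth_section E V s -> smooth_on V f -> smooth_on V (fun x => rho x (s x) f).
Proof.
move=> oV sVU ss sf; exact: (anc_smooth rho oV sVU ss).2.
Qed.

End Anchors.

(** * Brackets on sections *)

(** Reduces identities between vectors to identities between scalars, which [lra] decides. *)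
Lemma vect_eq (R : fieldType) (T : vectType R) (u v : T) :
  (forall i, coord (vbasis fullv) i u = coord (vbasis fullv) i v) -> u = v.
Proof.
move=> uv; rewrite (coord_vbasis (memvf u)) (coord_vbasis (memvf v)).
by apply: eq_bigr => i _; rewrite uv.
Qed.

Section AlmostLie.
Variables (R : realType) (M : manifold R) (U : set M) (E : vbundle U).
Variables (rho : anchor E) (B : section E -> section E -> section E).
Variable J : section E -> section E -> section E -> section E.

(* The common part of a Lie algebroid ([J = 0]) and of the degree -1 sections
   of a Lie oo-algebroid ([J] is, up to sign, the unary bracket of the ternary
   one): the Jacobi identity holds up to a term linear over functions in its
   last argument, which is enough for the anchor to preserve brackets. *)
Record almost_lie : Prop := AlmostLie {
  al_smooth : forall (V : set M) s t, open V -> V `<=` U ->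
    smooth_section E V s -> smooth_section E V t -> smooth_section E V (B s t);
  al_local : forall (V : set M) s s' t t', open V -> V `<=` U ->
    smooth_section E V s -> smooth_section E V s' ->
    smooth_section E V t -> smooth_section E V t' ->
    (forall x, V x -> s x = s' x) -> (forall x, V x -> t x = t' x) ->
    forall x, V x -> B s t x = B s' t' x;
  al_addl : forall (V : set M) s s' t, open V -> V `<=` U ->
    smooth_section E V s -> smooth_section E V s' -> smooth_section E V t ->
    forall x, V x -> B (fun y => s y + s' y) t x = B s t x + B s' t x;
  al_anti : forall (V : set M) s t, open V -> V `<=` U ->
    smooth_section E V s -> smooth_section E V t ->
    forall x, V x -> B s t x = - B t s x;
  al_leibniz : forall (V : set M) f s t, open V -> V `<=` U -> smooth_on V f ->
    smooth_section E V s -> smooth_section E V t ->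
    forall x, V x ->
      B s (fun y => f y *: t y) x = f x *: B s t x + rho x (s x) f *: t x;
  al_jacobi : forall (V : set M) s t u, open V -> V `<=` U ->
    smooth_section E V s -> smooth_section E V t -> smooth_section E V u ->
    forall x, V x -> B s (B t u) x + B t (B u s) x + B u (B s t) x = J s t u x;
  al_jlin : forall (V : set M) f s t u, open V -> V `<=` U -> smooth_on V f ->
    smooth_section E V s -> smooth_section E V t -> smooth_section E V u ->
    forall x, V x -> J s t (fun y => f y *: u y) x = f x *: J s t u x }.

Hypothesis alB : almost_lie.

Section Over.
Variables (V : set M) (oV : open V) (sVU : V `<=` U).
Let Ss := smooth_section E V.

Lemma al_addr s t t' x : Ss s -> Ss t -> Ss t' -> V x ->
  B s (fun y => t y + t' y) x = B s t x + B s t' x.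
Proof.
move=> ss st st' Vx; have stt' := smooth_sectionD oV st st'.
rewrite (al_anti alB oV) // (al_addl alB oV sVU) // opprD.
by rewrite -!(al_anti alB oV sVU).
Qed.

Lemma al_leibnizl f s t x : smooth_on V f -> Ss s -> Ss t -> V x ->
  B (fun y => f y *: s y) t x = f x *: B s t x - rho x (t x) f *: s x.
Proof.
move=> sf ss st Vx; have sfs := smooth_sectionZ oV sf ss.
rewrite (al_anti alB oV) // (al_leibniz alB oV sVU) // opprD -scalerN.
by rewrite -(al_anti alB oV sVU).
Qed.

(** A derivation kills 1 = 1 * 1, hence all constants. This makes the bracket linear over the reals
    in both arguments. *)
Lemma anc_cst x (u : E x) a : V x -> rho x u (fun=> a) = 0.
Proof.
move=> Vx; have [_ tlin tlei] := anc_tangent rho u (sVU Vx).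
have sc b : smooth_near x (fun=> b : R) by exact: smooth_on_near oV Vx (smooth_on_cst V b).
have d1 : rho x u (fun=> 1) = 0.
  have := tlei _ _ (sc 1) (sc 1); rewrite !mulr1 mul1r => /eqP.
  by rewrite -[X in X == _]addr0 (inj_eq (addrI _)) eq_sym => /eqP.
have d0 : rho x u (fun=> 0) = 0.
  have := tlei _ _ (sc 0) (sc 0); rewrite !mulr0 mul0r addr0.
  by [].
have := tlin a _ _ (sc 1) (sc 0); rewrite d1 d0 mulr0 addr0.
by rewrite mulr1 addr0.
Qed.

Lemma al_scalel a s t x : Ss s -> Ss t -> V x ->
  B (fun y => a *: s y) t x = a *: B s t x.
Proof.
move=> ss st Vx; rewrite (al_leibnizl (smooth_on_cst V a)) //.
by rewrite anc_cst // scale0r subr0.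
Qed.

Lemma al_scaler a s t x : Ss s -> Ss t -> V x ->
  B s (fun y => a *: t y) x = a *: B s t x.
Proof.
move=> ss st Vx; rewrite (al_leibniz alB oV sVU (smooth_on_cst V a)) //.
by rewrite anc_cst // scale0r addr0.
Qed.

Lemma al_oppr s t x : Ss s -> Ss t -> V x -> B s (fun y => - t y) x = - B s t x.
Proof.
move=> ss st Vx; rewrite -scaleN1r -al_scaler //.
by congr (B s _ x); apply: section_ext => y; rewrite scaleN1r.
Qed.

Lemma al_suml (I : Type) (r : seq I) (s : I -> section E) t x :
  (forall i, Ss (s i)) -> Ss t -> V x ->
  B (fun y => \sum_(i <- r) s i y) t x = \sum_(i <- r) B (s i) t x.
Proof.
move=> ss st Vx; apply: (additive_sum (L := fun s => B s t x) oV) => // q q' sq sq'.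
exact: (al_addl alB oV sVU).
Qed.

Lemma al_sumr (I : Type) (r : seq I) s (t : I -> section E) x :
  Ss s -> (forall i, Ss (t i)) -> V x ->
  B s (fun y => \sum_(i <- r) t i y) x = \sum_(i <- r) B s (t i) x.
Proof.
move=> ss st Vx; apply: (additive_sum (L := fun t => B s t x) oV) => // q q' sq sq'.
exact: al_addr.
Qed.

Lemma al_oppl s t x : Ss s -> Ss t -> V x -> B (fun y => - s y) t x = - B s t x.
Proof.
move=> ss st Vx; rewrite -scaleN1r -al_scalel //.
by congr (B _ t x); apply: section_ext => y; rewrite scaleN1r.
Qed.

(** The cyclic identity rewritten with all brackets nested on the left, the shape in which the sum
    over unshuffles delivers it. *)
Lemma al_jacobi_left s t u x : Ss s -> Ss t -> Ss u -> V x ->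
  B (B s t) u x - B (B s u) t x + B (B t u) s x = - J s t u x.
Proof.
move=> ss st su Vx.
have sm q q' : Ss q -> Ss q' -> Ss (B q q') by exact: (al_smooth alB).
rewrite -(al_jacobi alB oV sVU ss st su Vx).
have -> : B (B s u) t x = - B (B u s) t x.
  have ssu := sm _ _ ss su; have sus := sm _ _ su ss.
  rewrite -al_oppl //; apply: (al_local alB oV sVU) => //; first exact: smooth_sectionN.
  by move=> y Vy; rewrite (al_anti alB oV sVU).
rewrite (al_anti alB oV sVU ss) ?(al_anti alB oV sVU st) ?(al_anti alB oV sVU su) //;
  try exact: sm.
by rewrite !opprD !opprK addrC [X in _ + X = _]addrC addrA.
Qed.

(** Expand the Jacobi identity for [f u] by the Leibniz rule and subtract [f] times the one for [u].
    As [J] is linear over functions in its last argument, only the failure of the anchor to preserve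
    the bracket, applied to [f] and multiplying [u], survives. *)
Lemma al_jacobi_leibniz f s t u x : smooth_on V f -> Ss s -> Ss t -> Ss u -> V x ->
  (rho x (B s t x) f - (rho x (s x) (fun y => rho y (t y) f) -
     rho x (t x) (fun y => rho y (s y) f))) *: u x = 0.
Proof.
move=> sf ss st su Vx.
have sm q q' : Ss q -> Ss q' -> Ss (B q q') by exact: (al_smooth alB).
have sZ g q : smooth_on V g -> Ss q -> Ss (fun y => g y *: q y) by exact: smooth_sectionZ.
have sD q q' : Ss q -> Ss q' -> Ss (fun y => q y + q' y) by exact: smooth_sectionD.
have sN q : Ss q -> Ss (fun y => - q y) by exact: smooth_sectionN.
have sr q : Ss q -> smooth_on V (fun y => rho y (q y) f) by move=> sq; exact: smooth_on_anc.
have lr q q' q'' y : Ss q -> Ss q' -> Ss q'' -> (forall z, V z -> q' z = q'' z) ->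
    V y -> B q q' y = B q q'' y.
  by move=> sq sq' sq'' qq Vy; apply: (al_local alB oV sVU).
have dbl q q' : Ss q -> Ss q' -> B q (B q' (fun y => f y *: u y)) x =
    f x *: B q (B q' u) x + rho x (q x) f *: B q' u x +
    (rho x (q' x) f *: B q u x + rho x (q x) (fun y => rho y (q' y) f) *: u x).
  move=> sq sq'.
  have h1 := sZ _ _ sf (sm _ _ sq' su).
  have h2 := sZ _ _ (sr _ sq') su.
  rewrite (lr q (B q' _) _ x sq (sm _ _ sq' (sZ _ _ sf su)) (sD _ _ h1 h2)) //; last first.
    by move=> z Vz; rewrite (al_leibniz alB oV sVU).
  rewrite al_addr // !(al_leibniz alB oV sVU) //; [exact: sr|exact: sm].
have sfu := sZ _ _ sf su.
have swap q q' : Ss q -> Ss q' -> B t (B q q') x = - B t (B q' q) x.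
  move=> sq sq'; rewrite -al_oppr //; last exact: sm.
  apply: lr => //; [exact: sm|apply: sN; exact: sm|].
  by move=> z Vz; rewrite (al_anti alB oV sVU).
have := al_jacobi alB oV sVU ss st sfu Vx.
rewrite (al_jlin alB oV sVU) // -(al_jacobi alB oV sVU ss st su Vx) dbl //.
rewrite !(swap _ s) // dbl // al_leibnizl //; last exact: sm.
rewrite (al_anti alB oV sVU su (sm _ _ ss st)) //.
move=> H; apply: vect_eq => i; have := congr1 (coord (vbasis fullv) i) H.
rewrite !(linearD, linearB, linearN, linearZ, linear0) /=.
by rewrite /GRing.scale /=; lra.
Qed.

End Over.

(** In [al_jacobi_leibniz] take for [u] a frame section: it does not vanish at [x], so its
    coefficient must. *)
Lemma al_anchor (V : set M) s t f x : open V -> V `<=` U ->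
  smooth_section E V s -> smooth_section E V t -> V x -> smooth_near x f ->
  rho x (B s t x) f =
  rho x (s x) (fun y => rho y (t y) f) - rho x (t x) (fun y => rho y (s y) f).
Proof.
move=> oV sVU ss st Vx [V' [oV' V'x sf]].
have [e fe ex] := vframes_cover E (sVU x Vx).
have [oe _] := vframes_open fe.
pose W := V `&` V' `&` e.1.
have oW : open W by do 2 (apply: openI => //).
have Wx : W x by [].
have sWU : W `<=` U by move=> y [[/sVU]].
have sW q : smooth_section E V q -> smooth_section E W q.
  by apply: smooth_section_sub => y [[]].
have sfW : smooth_on W f by apply: smooth_on_sub sf => y [[]].
(* In rank 0 there is no frame section to cancel, but all fibre elements over [x] vanish and so do
   both sides. *)
have [r0|] := posnP (vrank E).
  have z (u : E x) : u = 0.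
    rewrite (frame_expand u fe ex) big1 // => i _; have := ltn_ord i.
    by rewrite [X in (_ < X)%N]r0.
  have sr q : smooth_section E W q -> smooth_near x (fun y => rho y (q y) f).
    by move=> sq; apply: (smooth_on_near oW Wx); exact: smooth_on_anc.
  rewrite (z (s x)) (z (t x)) (z (B s t x)) !anc0 ?subrr //.
  - by apply: sr; exact: sW.
  - by apply: sr; exact: sW.
  - exact: smooth_on_near sfW.
case rE : (vrank E) => [//|n] _.
pose i : 'I_(vrank E) := cast_ord (esym rE) ord0.
have se : smooth_section E W (fun y => tnth (e.2 y) i).
  by apply: smooth_section_sub (smooth_section_frame i fe) => y [].
have := al_jacobi_leibniz oW sWU sfW (sW _ ss) (sW _ st) se Wx.
move=> /eqP; rewrite scaler_eq0 => /orP[|/eqP e0]; first by rewrite subr_eq0 => /eqP.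
have := basis_not0 (vframes_basis fe ex) (mem_tnth i _).
by rewrite e0 eqxx.
Qed.

End AlmostLie.

(** * Unshuffles of two and three elements *)

Section Unshuffles.

Definition perm_of_tuple n (t : n.-tuple 'I_n) (ut : uniq t) : 'S_n :=
  perm (elimT (tuple_uniqP t) ut).

Lemma perm_of_tupleE n (t : n.-tuple 'I_n) (ut : uniq t) i :
  perm_of_tuple ut i = tnth t i.
Proof. exact: permE. Qed.

Local Notation o20 := (Ordinal (isT : 0 < 2)%N).
Local Notation o21 := (Ordinal (isT : 1 < 2)%N).
Local Notation o30 := (Ordinal (isT : 0 < 3)%N).
Local Notation o31 := (Ordinal (isT : 1 < 3)%N).
Local Notation o32 := (Ordinal (isT : 2 < 3)%N).

Definition perm01 : 'S_2 := @perm_of_tuple 2 [tuple o20; o21] isT.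
Definition perm10 : 'S_2 := @perm_of_tuple 2 [tuple o21; o20] isT.
Definition perm012 : 'S_3 := @perm_of_tuple 3 [tuple o30; o31; o32] isT.
Definition perm021 : 'S_3 := @perm_of_tuple 3 [tuple o30; o32; o31] isT.
Definition perm102 : 'S_3 := @perm_of_tuple 3 [tuple o31; o30; o32] isT.
Definition perm120 : 'S_3 := @perm_of_tuple 3 [tuple o31; o32; o30] isT.
Definition perm201 : 'S_3 := @perm_of_tuple 3 [tuple o32; o30; o31] isT.
Definition perm210 : 'S_3 := @perm_of_tuple 3 [tuple o32; o31; o30] isT.

(** A duplicate-free list with as many entries as the group has elements is exhaustive; the actual
    order of enumeration never has to be computed. *)
Lemma perm_enum_S2 : perm_eq (index_enum (Finite.clone _ 'S_2)) [:: perm01; perm10].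
Proof.
rewrite perm_sym; apply: uniq_perm; last first.
- have [] // := @uniq_min_size _ [:: perm01; perm10] (index_enum (Finite.clone _ 'S_2)).
  + by apply: (@map_uniq _ _ (fun s : 'S_2 => s o20)); rewrite /= !perm_of_tupleE.
  + by move=> s _; rewrite mem_index_enum.
  by rewrite -[index_enum _]enumT -cardE card_Sn.
- exact: index_enum_uniq.
- by apply: (@map_uniq _ _ (fun s : 'S_2 => s o20)); rewrite /= !perm_of_tupleE.
Qed.

Lemma perm_enum_S3 : perm_eq (index_enum (Finite.clone _ 'S_3))
  [:: perm012; perm021; perm102; perm120; perm201; perm210].
Proof.
set s := (X in perm_eq _ X).
have us : uniq s.
  (* The images of two points already tell the six permutations apart. *)
  apply: (@map_uniq _ _ (fun s : 'S_3 => (s o30, s o31))).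
  by rewrite /= !perm_of_tupleE.
rewrite perm_sym; apply: uniq_perm => //; first exact: index_enum_uniq.
have [] // := @uniq_min_size _ s (index_enum (Finite.clone _ 'S_3)) us.
  by move=> p _; rewrite mem_index_enum.
by rewrite -[index_enum _]enumT -cardE card_Sn.
Qed.

Lemma unshuffle2E i (s : 'S_2) : unshuffle i s =
  (((1 < i) || (i <= 0)) ==> (s o20 < s o21))%N.
Proof.
apply/idP/idP => [/forallP/(_ o20)/forallP/(_ o21) //|H].
apply/forallP => -[[|[|//]] ia]; apply/forallP => -[[|[|//]] ib] //=.
by rewrite (bool_irrelevance ia isT) (bool_irrelevance ib isT).
Qed.

Lemma unshuffle3E i (s : 'S_3) : unshuffle i s =
  [&& ((1 < i) || (i <= 0)) ==> (s o30 < s o31),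
      ((2 < i) || (i <= 0)) ==> (s o30 < s o32) &
      ((2 < i) || (i <= 1)) ==> (s o31 < s o32)]%N.
Proof.
apply/idP/idP => [/forallP H|/and3P[H01 H02 H12]].
  by apply/and3P; split; [move: (H o30) => /forallP/(_ o31)|
    move: (H o30) => /forallP/(_ o32)|move: (H o31) => /forallP/(_ o32)].
apply/forallP => -[[|[|[|//]]] ia]; apply/forallP => -[[|[|[|//]]] ib] //=;
by rewrite (bool_irrelevance ia isT) (bool_irrelevance ib isT).
Qed.

Lemma sum_unshuffle2 (T : nmodType) (G : nat -> 'S_2 -> T) :
  \sum_(1 <= i < 3) \sum_(s : 'S_2 | unshuffle i s) G i s =
  G 1%N perm01 + G 1%N perm10 + G 2%N perm01.
Proof.
rewrite big_nat_recl // big_nat1 !(perm_big _ perm_enum_S2) /=.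
by rewrite !big_cons !big_nil !unshuffle2E !perm_of_tupleE /= !addr0.
Qed.

(** Un(1,2) and Un(2,1) have three elements each, and Un(3,0) contains only the identity. *)
Lemma sum_unshuffle3 (T : nmodType) (G : nat -> 'S_3 -> T) :
  \sum_(1 <= i < 4) \sum_(s : 'S_3 | unshuffle i s) G i s =
  (G 1%N perm012 + (G 1%N perm102 + G 1%N perm201)) +
  ((G 2%N perm012 + (G 2%N perm021 + G 2%N perm120)) + G 3%N perm012).
Proof.
do 2 (rewrite big_nat_recl //); rewrite big_nat1 !(perm_big _ perm_enum_S3) /=.
by rewrite !big_cons !big_nil !unshuffle3E !perm_of_tupleE /= !addr0.
Qed.

Lemma koszul2E (R : realType) (ks : 2.-tuple nat) (s : 'S_2) :
  koszul R ks s =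
  if (s o21 < s o20)%N then (-1) ^+ (tnth ks (s o20) * tnth ks (s o21)) else 1.
Proof.
rewrite /koszul !big_ord_recl big_ord0; do ?rewrite big_mkcond /= !big_ord_recl big_ord0 /=.
rewrite (_ : lift ord0 ord0 = o21); last exact: val_inj.
rewrite (_ : ord0 = o20); last exact: val_inj.
by rewrite !mul1r !mulr1.
Qed.

Lemma koszul3E (R : realType) (ks : 3.-tuple nat) (s : 'S_3) :
  koszul R ks s =
  (if (s o31 < s o30)%N then (-1) ^+ (tnth ks (s o30) * tnth ks (s o31)) else 1) *
  (if (s o32 < s o30)%N then (-1) ^+ (tnth ks (s o30) * tnth ks (s o32)) else 1) *
  (if (s o32 < s o31)%N then (-1) ^+ (tnth ks (s o31) * tnth ks (s o32)) else 1).
Proof.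
rewrite /koszul !big_ord_recl big_ord0; do ?rewrite big_mkcond /= !big_ord_recl big_ord0 /=.
rewrite (_ : lift ord0 (lift ord0 ord0) = o32); last exact: val_inj.
rewrite (_ : lift ord0 ord0 = o31); last exact: val_inj.
rewrite (_ : ord0 = o30); last exact: val_inj.
by rewrite !mul1r !mulr1.
Qed.

Lemma permt2 (T : Type) (xs : 2.-tuple T) (s : 'S_2) :
  permt xs s = [tuple tnth xs (s o20); tnth xs (s o21)].
Proof.
apply: eq_from_tnth => i; rewrite tnth_mktuple; case: i => -[|[|//]] i.
  by rewrite (bool_irrelevance i isT).
by rewrite (bool_irrelevance i isT).
Qed.

Lemma permt3 (T : Type) (xs : 3.-tuple T) (s : 'S_3) :
  permt xs s = [tuple tnth xs (s o30); tnth xs (s o31); tnth xs (s o32)].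
Proof.
apply: eq_from_tnth => i; rewrite tnth_mktuple; case: i => -[|[|[|//]]] i;
by rewrite (bool_irrelevance i isT).
Qed.

End Unshuffles.

(** * Low brackets of a Lie oo-algebroid *)

Section TupleUpdate.
Variable T : Type.

Lemma tupd3_0 (x y z a : T) : tupd [tuple x; y; z] ord0 a = [tuple a; y; z].
Proof. by apply: eq_from_tnth => -[[|[|[|//]]] i]; rewrite tnth_mktuple. Qed.

Lemma tupd3_1 (x y z a : T) :
  tupd [tuple x; y; z] (Ordinal (isT : 1 < 3)%N) a = [tuple x; a; z].
Proof. by apply: eq_from_tnth => -[[|[|[|//]]] i]; rewrite tnth_mktuple. Qed.

Lemma tupd3_2 (x y z a : T) :
  tupd [tuple x; y; z] (Ordinal (isT : 2 < 3)%N) a = [tuple x; y; a].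
Proof. by apply: eq_from_tnth => -[[|[|[|//]]] i]; rewrite tnth_mktuple. Qed.

End TupleUpdate.

Section Placement.
Variables (R : realType) (M : manifold R) (U : set M) (E : nat -> vbundle U).

(** The inclusion of one degree into the graded sum. The type of the value depends on [j], so [s] is
    transported along a proof of [k = j]; such proofs are unique in [nat], which makes the cast
    trivial at [j = k]. *)
Definition in_degree k (s : section (E k)) : gsection E := fun j =>
  match k =P j with
  | ReflectT kj => ecast i (section (E i)) kj s
  | ReflectF _ => fun x => 0 : E j x
  end.

Lemma in_degreeE k (s : section (E k)) : in_degree s k = s.
Proof. by rewrite /in_degree; case: eqP => // kk; rewrite eq_axiomK. Qed.

Lemma in_degree_neq k (s : section (E k)) j x : j != k -> in_degree s j x = 0.
Proof. by rewrite /in_degree eq_sym; case: eqP. Qed.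

Lemma in_degree_lin k f (s t : section (E k)) :
  in_degree (fun x => f x *: s x + t x) = gs_lin f (in_degree s) (in_degree t).
Proof.
apply: functional_extensionality_dep => j; apply: section_ext => x.
have [->|jk] := eqVneq j k; first by rewrite /gs_lin !in_degreeE.
by rewrite /gs_lin !in_degree_neq // scaler0 addr0.
Qed.

Lemma homog_in_degree k (V : set M) (s : section (E k)) :
  smooth_section (E k) V s -> homog k V (in_degree s).
Proof.
by move=> ss; split=> [j x jk _|]; rewrite ?in_degreeE // in_degree_neq.
Qed.

Lemma homog_eq_in_degree k (V : set M) (x : gsection E) :
  homog k V x -> gs_eq V x (in_degree (x k)).
Proof.
move=> [x0 _] j p Vp; have [->|jk] := eqVneq j k; first by rewrite in_degreeE.
by rewrite x0 // in_degree_neq.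
Qed.

Lemma homog_sub k (V V' : set M) (x : gsection E) :
  V' `<=` V -> homog k V x -> homog k V' x.
Proof.
move=> sVV [x0 sx]; split=> [j p jk /sVV|]; first exact: x0.
exact: smooth_section_sub sx.
Qed.

Lemma homog_ext k (V : set M) (x y : gsection E) :
  open V -> gs_eq V x y -> homog k V x -> homog k V y.
Proof.
move=> oV xy [x0 sx]; split=> [j p jk Vp|]; first by rewrite -xy // x0.
by apply: smooth_section_ext sx => // p Vp; exact: xy.
Qed.

Definition gs_zero : gsection E := fun j x => 0.

Lemma homog0 k (V : set M) : homog k V gs_zero.
Proof. by split=> //; exact: smooth_section0. Qed.

Lemma homog_tuple2 k l (V : set M) (x y : gsection E) :
  homog k V x -> homog l V y -> homog_tuple [tuple k; l] V [tuple x; y].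
Proof. by move=> hx hy [[|[|//]] i]. Qed.

Lemma homog_tuple3 k l h (V : set M) (x y z : gsection E) :
  homog k V x -> homog l V y -> homog h V z ->
  homog_tuple [tuple k; l; h] V [tuple x; y; z].
Proof. by move=> hx hy hz [[|[|[|//]]] i]. Qed.

End Placement.

Section LowBrackets.
Variables (R : realType) (M : manifold R) (U : set M) (F : singular_foliation M).
Variable W : universal_Linfty U F.

Local Notation E := (gr_bundle W).
Local Notation rho := (gr_anchor W).
Local Notation br := (uL_br W).
Let LW := uL_Linfty W.

Variables (V : set M) (oV : open V) (sVU : V `<=` U).
Implicit Types (x y z : gsection E).

Lemma br1_homog k x : homog k V x -> homog k.-1 V (br [:: x]).
Proof.
move=> hx; have := Li_degree LW (ks := [tuple k]) (xs := [tuple x]) oV sVU isT.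
by rewrite /= addn0; apply => -[[|//] i].
Qed.

Lemma br2_homog k l x y : homog k V x -> homog l V y ->
  homog (k + l).-1 V (br [:: x; y]).
Proof.
move=> hx hy; have := Li_degree LW oV sVU (isT : (0 < 2)%N) (homog_tuple2 hx hy).
by rewrite /= addn0.
Qed.

Lemma br3_homog k l h x y z : homog k V x -> homog l V y -> homog h V z ->
  homog (k + (l + h)).-1 V (br [:: x; y; z]).
Proof.
move=> hx hy hz; have := Li_degree LW oV sVU (isT : (0 < 3)%N) (homog_tuple3 hx hy hz).
by rewrite /= addn0.
Qed.

Lemma br2_local k l x x' y y' : homog k V x -> homog l V y ->
  gs_eq V x x' -> gs_eq V y y' -> gs_eq V (br [:: x; y]) (br [:: x'; y']).
Proof.
move=> hx hy xx yy; have hx' := homog_ext oV xx hx; have hy' := homog_ext oV yy hy.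
have := Li_local LW oV sVU (isT : (0 < 2)%N) (homog_tuple2 hx hy) (homog_tuple2 hx' hy').
by apply => -[[|[|//]] i].
Qed.

Lemma br3_local k l h x x' y y' z z' : homog k V x -> homog l V y -> homog h V z ->
  gs_eq V x x' -> gs_eq V y y' -> gs_eq V z z' ->
  gs_eq V (br [:: x; y; z]) (br [:: x'; y'; z']).
Proof.
move=> hx hy hz xx yy zz.
have hx' := homog_ext oV xx hx; have hy' := homog_ext oV yy hy.
have hz' := homog_ext oV zz hz.
have := Li_local LW oV sVU (isT : (0 < 3)%N) (homog_tuple3 hx hy hz) (homog_tuple3 hx' hy' hz').
by apply => -[[|[|[|//]]] i].
Qed.

Lemma br2_sym k l x y j p : homog k V x -> homog l V y -> V p ->
  br [:: y; x] j p = (-1) ^+ (k * l) *: br [:: x; y] j p.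
Proof.
move=> hx hy Vp; have := Li_symmetric LW perm10 oV sVU (isT : (0 < 2)%N) (homog_tuple2 hx hy) j Vp.
by rewrite permt2 koszul2E !perm_of_tupleE /= mulnC.
Qed.

Lemma br2_leibniz k l f y a b j p : smooth_on V f ->
  homog k V y -> homog l V a -> homog l V b -> V p ->
  br [:: y; gs_lin f a b] j p = f p *: br [:: y; a] j p + br [:: y; b] j p +
    (if k == 1%N then rho p (y 1%N p) f *: a j p else 0).
Proof. by move=> sf hy ha hb Vp; exact: (Li_leibniz LW oV sVU sf hy ha hb). Qed.

Lemma br3_lin0 k l h f a b y z j p : smooth_on V f ->
  homog k V a -> homog k V b -> homog l V y -> homog h V z -> V p ->
  br [:: gs_lin f a b; y; z] j p = f p *: br [:: a; y; z] j p + br [:: b; y; z] j p.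
Proof.
move=> sf ha hb hy hz Vp.
have := Li_multilinear LW (i := ord0) oV sVU (isT : 3 != 2)%N (homog_tuple3 ha hy hz) sf ha hb j Vp.
by rewrite !tupd3_0.
Qed.

Lemma br3_lin1 k l h f a b x z j p : smooth_on V f ->
  homog k V x -> homog l V a -> homog l V b -> homog h V z -> V p ->
  br [:: x; gs_lin f a b; z] j p = f p *: br [:: x; a; z] j p + br [:: x; b; z] j p.
Proof.
move=> sf hx ha hb hz Vp.
have := Li_multilinear LW (i := Ordinal (isT : 1 < 3)%N) oV sVU (isT : 3 != 2)%N
  (homog_tuple3 hx ha hz) sf ha hb j Vp.
by rewrite !tupd3_1.
Qed.

Lemma br3_lin2 k l h f a b x y j p : smooth_on V f ->
  homog k V x -> homog l V y -> homog h V a -> homog h V b -> V p ->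
  br [:: x; y; gs_lin f a b] j p = f p *: br [:: x; y; a] j p + br [:: x; y; b] j p.
Proof.
move=> sf hx hy ha hb Vp.
have := Li_multilinear LW (i := Ordinal (isT : 2 < 3)%N) oV sVU (isT : 3 != 2)%N
  (homog_tuple3 hx hy ha) sf ha hb j Vp.
by rewrite !tupd3_2.
Qed.

Lemma gs_lin0 : gs_lin (fun=> 1) (gs_zero E) (gs_zero E) = gs_zero E.
Proof.
by do 2 (apply: functional_extensionality_dep => ?); rewrite /gs_lin scaler0 addr0.
Qed.

(** The zero section is homogeneous of every degree, and 0 = 1 * 0 + 0 makes the bracket equal to
    twice itself. *)
Lemma br2_zero l y j p : homog l V y -> V p -> br [:: gs_zero E; y] j p = 0.
Proof.
move=> hy Vp; have h0 k := @homog0 R M U E k V.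
rewrite (br2_sym j hy (h0 0%N) Vp).
have := br2_leibniz j (smooth_on_cst V 1) hy (h0 0%N) (h0 0%N) Vp.
rewrite gs_lin0 scaler0 if_same addr0 scale1r => /eqP.
rewrite -[X in X == _]addr0 (inj_eq (addrI _)) eq_sym => /eqP ->.
by rewrite scaler0.
Qed.

Lemma br3_zero l h y z j p : homog l V y -> homog h V z -> V p ->
  br [:: gs_zero E; y; z] j p = 0.
Proof.
move=> hy hz Vp; have h0 k := @homog0 R M U E k V.
have := br3_lin0 j (smooth_on_cst V 1) (h0 0%N) (h0 0%N) hy hz Vp.
rewrite gs_lin0 scale1r => /eqP.
by rewrite -[X in X == _]addr0 (inj_eq (addrI _)) eq_sym => /eqP ->.
Qed.

(** The value lies in [E 0], a bundle of rank 0. *)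
Lemma br1_degree1 x : homog 1 V x -> gs_eq V (br [:: x]) (gs_zero E).
Proof.
move=> /br1_homog[x0 _] j p Vp; have [->|j0] := eqVneq j 0%N; last exact: x0.
have [e fe ep] := vframes_cover (E 0%N) (sVU Vp).
rewrite (frame_expand (br [:: x] 0%N p) fe ep) big1 // => i _; have := ltn_ord i.
by rewrite [X in (_ < X)%N](Li_zero LW).
Qed.

(** The third unshuffle would contribute {{y}, x}, and {y} vanishes for degree reasons. *)
Lemma br_jacobi2 x y j p : homog 2 V x -> homog 1 V y -> V p ->
  br [:: br [:: x]; y] j p + br [:: br [:: x; y]] j p = 0.
Proof.
move=> hx hy Vp.
have := Li_jacobi LW oV sVU (isT : (0 < 2)%N) (homog_tuple2 hx hy) j Vp.
rewrite sum_unshuffle2 !permt2 !koszul2E !perm_of_tupleE /= !scale1r.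
have h0 := br1_degree1 hy.
rewrite (br2_local (br1_homog hy) hx h0 (fun _ _ _ => erefl)) // (br2_zero j hx) //.
by rewrite scaler0 addr0.
Qed.

(** Terms with an inner unary bracket vanish for degree reasons. All arguments being odd, the Koszul
    sign is the signature of the unshuffle. *)
Lemma br_jacobi3 x y z j p : homog 1 V x -> homog 1 V y -> homog 1 V z -> V p ->
  br [:: br [:: x; y]; z] j p - br [:: br [:: x; z]; y] j p +
  br [:: br [:: y; z]; x] j p + br [:: br [:: x; y; z]] j p = 0.
Proof.
move=> hx hy hz Vp.
have := Li_jacobi LW oV sVU (isT : (0 < 3)%N) (homog_tuple3 hx hy hz) j Vp.
rewrite sum_unshuffle3 !permt3 !koszul3E !perm_of_tupleE /= !mul1r !mulr1.
have z3 a b c : homog 1 V a -> homog 1 V b -> homog 1 V c ->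
    br [:: br [:: a]; b; c] j p = 0.
  move=> ha hb hc; have h0 := br1_degree1 ha.
  rewrite (br3_local (br1_homog ha) hb hc h0 (fun _ _ _ => erefl) (fun _ _ _ => erefl)) //.
  exact: br3_zero hb hc Vp.
rewrite !z3 // !scaler0 !add0r !scale1r.
by rewrite mulrNN mulr1 scale1r scaleN1r addrA.
Qed.

End LowBrackets.

(** * Sections of degrees -1 and -2 *)

Section Degree12.
Variables (R : realType) (M : manifold R) (U : set M) (F : singular_foliation M).
Variable W : universal_Linfty U F.

Local Notation E := (gr_bundle W).
Local Notation rho := (gr_anchor W).
Local Notation br := (uL_br W).

(* The digits are the opposite degrees of the arguments. *)
Definition bracket11 (s t : section (E 1%N)) : section (E 1%N) :=
  br [:: in_degree s; in_degree t] 1%N.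
Definition bracket12 (s : section (E 1%N)) (e : section (E 2%N)) : section (E 2%N) :=
  br [:: in_degree s; in_degree e] 2%N.
Definition bracket111 (s t u : section (E 1%N)) : section (E 2%N) :=
  br [:: in_degree s; in_degree t; in_degree u] 2%N.
Definition d_section k (e : section (E k.+1)) : section (E k) := fun x => gr_d W k x (e x).

Section Over.
Variables (V : set M) (oV : open V) (sVU : V `<=` U).
Local Notation S1 := (smooth_section (E 1%N) V).
Local Notation S2 := (smooth_section (E 2%N) V).

Let hd k (s : section (E k)) : smooth_section (E k) V s -> homog k V (in_degree s).
Proof. exact: homog_in_degree. Qed.

Let gsd k (s t : section (E k)) : (forall x, V x -> s x = t x) ->
  gs_eq V (in_degree s) (in_degree t).
Proof.
move=> st j x Vx; have [->|jk] := eqVneq j k; first by rewrite !in_degreeE st.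
by rewrite !in_degree_neq.
Qed.

Lemma bracket11_smooth s t : S1 s -> S1 t -> S1 (bracket11 s t).
Proof. by move=> /hd hs /hd ht; have [_] := br2_homog oV sVU hs ht. Qed.

Lemma bracket12_smooth s e : S1 s -> S2 e -> S2 (bracket12 s e).
Proof. by move=> /hd hs /hd he; have [_] := br2_homog oV sVU hs he. Qed.

Lemma bracket111_smooth s t u : S1 s -> S1 t -> S1 u -> S2 (bracket111 s t u).
Proof. by move=> /hd hs /hd ht /hd hu; have [_] := br3_homog oV sVU hs ht hu. Qed.

Lemma d_section_smooth k (e : section (E k.+1)) :
  smooth_section (E k.+1) V e -> smooth_section (E k) V (d_section e).
Proof. exact: vbm_smooth. Qed.

Lemma bracket11_local s s' t t' x : S1 s -> S1 t ->
  (forall x, V x -> s x = s' x) -> (forall x, V x -> t x = t' x) ->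
  V x -> bracket11 s t x = bracket11 s' t' x.
Proof.
by move=> /hd hs /hd ht /gsd ss /gsd tt; exact: (br2_local oV sVU hs ht ss tt).
Qed.

Lemma bracket12_local s s' e e' x : S1 s -> S2 e ->
  (forall x, V x -> s x = s' x) -> (forall x, V x -> e x = e' x) ->
  V x -> bracket12 s e x = bracket12 s' e' x.
Proof.
by move=> /hd hs /hd ht /gsd ss /gsd tt; exact: (br2_local oV sVU hs ht ss tt).
Qed.

Lemma bracket111_local s s' t t' u u' x : S1 s -> S1 t -> S1 u ->
  (forall x, V x -> s x = s' x) -> (forall x, V x -> t x = t' x) ->
  (forall x, V x -> u x = u' x) -> V x -> bracket111 s t u x = bracket111 s' t' u' x.
Proof.
move=> /hd hs /hd ht /hd hu /gsd ss /gsd tt /gsd uu.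
exact: (br3_local oV sVU hs ht hu ss tt uu).
Qed.

(** Graded symmetry in odd degree is antisymmetry. *)
Lemma bracket11_anti s t x : S1 s -> S1 t -> V x -> bracket11 s t x = - bracket11 t s x.
Proof.
by move=> /hd hs /hd ht Vx; rewrite /bracket11 (br2_sym oV sVU 1 ht hs Vx) expr1 scaleN1r.
Qed.

Lemma bracket11_lin f s t t' x : smooth_on V f -> S1 s -> S1 t -> S1 t' -> V x ->
  bracket11 s (fun y => f y *: t y + t' y) x =
  f x *: bracket11 s t x + bracket11 s t' x + rho x (s x) f *: t x.
Proof.
move=> sf /hd hs /hd ht /hd ht' Vx; rewrite /bracket11 in_degree_lin.
by rewrite (br2_leibniz oV sVU 1 sf hs ht ht' Vx) eqxx !in_degreeE.
Qed.

Lemma bracket11_lincl a s s' t x : S1 s -> S1 s' -> S1 t -> V x ->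
  bracket11 (fun y => a *: s y + s' y) t x = a *: bracket11 s t x + bracket11 s' t x.
Proof.
move=> ss ss' st Vx.
have sss := smooth_section_lin oV (smooth_on_cst V a) ss ss'.
rewrite bracket11_anti // (bracket11_lin (smooth_on_cst V a)) // (anc_cst _ oV sVU) //
  scale0r addr0.
by rewrite opprD -scalerN -!bracket11_anti.
Qed.

Lemma bracket11_zero t x : S1 t -> V x -> bracket11 (fun=> 0) t x = 0.
Proof.
move=> st Vx; have s0 := @smooth_section0 R M U (E 1%N) V.
have := bracket11_lincl 1 s0 s0 st Vx.
rewrite (_ : (fun y => _) = fun y => 0); last first.
  by apply: section_ext => y; rewrite scaler0 addr0.
by rewrite scale1r => /eqP; rewrite -[X in X == _]addr0 (inj_eq (addrI _)) eq_sym => /eqP.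
Qed.

Lemma bracket11_opp s t x : S1 s -> S1 t -> V x -> bracket11 (fun y => - s y) t x = -
  bracket11 s t x.
Proof.
move=> ss st Vx; have s0 := @smooth_section0 R M U (E 1%N) V.
rewrite -scaleN1r -[RHS]addr0 -(bracket11_zero st Vx) -bracket11_lincl //.
by congr (bracket11 _ t x); apply: section_ext => y; rewrite scaleN1r addr0.
Qed.

Lemma bracket12_lin f s e e' x : smooth_on V f -> S1 s -> S2 e -> S2 e' -> V x ->
  bracket12 s (fun y => f y *: e y + e' y) x =
  f x *: bracket12 s e x + bracket12 s e' x + rho x (s x) f *: e x.
Proof.
move=> sf /hd hs /hd ht /hd ht' Vx; rewrite /bracket12 in_degree_lin.
by rewrite (br2_leibniz oV sVU 2 sf hs ht ht' Vx) eqxx !in_degreeE.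
Qed.

(** No derivative of [f] appears: after exchanging the arguments the first one has degree -2, and
    only degree -1 acts through the anchor. *)
Lemma bracket12_linl f s s' e x : smooth_on V f -> S1 s -> S1 s' -> S2 e -> V x ->
  bracket12 (fun y => f y *: s y + s' y) e x = f x *: bracket12 s e x + bracket12 s' e x.
Proof.
move=> sf hs hs' /hd he Vx.
have hl : S1 (fun y => f y *: s y + s' y) by exact: smooth_section_lin.
rewrite /bracket12 !(br2_sym oV sVU 2 he (hd _) Vx) // in_degree_lin.
by rewrite (br2_leibniz oV sVU 2 sf he (hd hs) (hd hs') Vx) /= addr0 !expr2 mulrNN mulr1 !scale1r.
Qed.

Lemma bracket111_lin0 f s s' t u x : smooth_on V f -> S1 s -> S1 s' -> S1 t -> S1 u -> V x ->
  bracket111 (fun y => f y *: s y + s' y) t u x = f x *: bracket111 s t u x + bracket111 s' t u x.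
Proof.
move=> sf /hd hs /hd hs' /hd ht /hd hu Vx; rewrite /bracket111 in_degree_lin.
exact: (br3_lin0 oV sVU 2 sf hs hs' ht hu Vx).
Qed.

Lemma bracket111_lin1 f s t t' u x : smooth_on V f -> S1 s -> S1 t -> S1 t' -> S1 u -> V x ->
  bracket111 s (fun y => f y *: t y + t' y) u x = f x *: bracket111 s t u x + bracket111 s t' u x.
Proof.
move=> sf /hd hs /hd ht /hd ht' /hd hu Vx; rewrite /bracket111 in_degree_lin.
exact: (br3_lin1 oV sVU 2 sf hs ht ht' hu Vx).
Qed.

Lemma bracket111_lin2 f s t u u' x : smooth_on V f -> S1 s -> S1 t -> S1 u -> S1 u' -> V x ->
  bracket111 s t (fun y => f y *: u y + u' y) x = f x *: bracket111 s t u x + bracket111 s t u' x.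
Proof.
move=> sf /hd hs /hd ht /hd hu /hd hu' Vx; rewrite /bracket111 in_degree_lin.
exact: (br3_lin2 oV sVU 2 sf hs ht hu hu' Vx).
Qed.

Lemma bracket111_zero s t x : S1 s -> S1 t -> V x -> bracket111 s t (fun=> 0) x = 0.
Proof.
move=> ss st Vx; have s0 := @smooth_section0 R M U (E 1%N) V.
have := bracket111_lin2 (smooth_on_cst V 1) ss st s0 s0 Vx.
rewrite (_ : (fun y => _) = fun y => 0); last first.
  by apply: section_ext => y; rewrite scaler0 addr0.
by rewrite scale1r => /eqP; rewrite -[X in X == _]addr0 (inj_eq (addrI _)) eq_sym => /eqP.
Qed.

Let brd k (s : gsection E) : homog k V s -> gs_eq V s (in_degree (s k)).
Proof. exact: homog_eq_in_degree. Qed.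

Let refl (s : gsection E) : gs_eq V s s. Proof. by []. Qed.

Lemma bracket11_jacobi s t u x : S1 s -> S1 t -> S1 u -> V x ->
  bracket11 (bracket11 s t) u x - bracket11 (bracket11 s u) t x + bracket11 (bracket11 t u) s x +
  d_section (bracket111 s t u) x = 0.
Proof.
move=> /hd hs /hd ht /hd hu Vx; rewrite -[RHS](br_jacobi3 oV sVU 1 hs ht hu Vx).
(* An inner bracket is a graded section; over [V] it agrees with its degree -1 component placed back
   in the graded sum. *)
have E2 a b c : homog 1 V a -> homog 1 V b -> homog 1 V c ->
    br [:: br [:: a; b]; c] 1%N x = br [:: in_degree (br [:: a; b] 1%N); c] 1%N x.
  move=> ha hb hc; have hab := br2_homog oV sVU ha hb.
  by apply: (br2_local oV sVU hab hc (brd hab) (refl c)).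
rewrite !E2 //.
by rewrite (uL_linear oV sVU (br3_homog oV sVU hs ht hu)).
Qed.

(** Compatibility of d with the binary bracket, from the Jacobi identity for two arguments;
    exchanging degrees -2 and -1 costs no sign. *)
Lemma bracket11_d_section e s x : S2 e -> S1 s -> V x ->
  bracket11 (d_section e) s x + d_section (bracket12 s e) x = 0.
Proof.
move=> se /hd hs Vx; have he := hd se.
rewrite -[RHS](br_jacobi2 oV sVU 1 he hs Vx); congr (_ + _).
  have hde := br1_homog oV sVU he.
  rewrite (br2_local oV sVU hde hs (brd hde) (refl _)) //.
  rewrite /bracket11; apply: (br2_local oV sVU _ hs _ (refl _)) => //.
    exact/hd/d_section_smooth.
  by apply: gsd => y Vy; rewrite (uL_linear oV sVU he) // in_degreeE.
rewrite (uL_linear oV sVU (br2_homog oV sVU he hs)) // /d_section; congr (gr_d W 1 x _).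
by rewrite /bracket12 (br2_sym oV sVU 2 he hs Vx) expr2 mulrNN mulr1 scale1r.
Qed.

End Over.

(** The Jacobi identity fails by d of the ternary bracket, and both of these are linear over
    functions. *)
Lemma bracket11_almost_lie : almost_lie rho bracket11 (fun s t u => d_section (bracket111 s t u)).
Proof.
split.
- by move=> V s t oV sVU; exact: bracket11_smooth.
- by move=> V s s' t t' oV sVU ss _ st _ es et x Vx; exact: (bracket11_local oV sVU ss st es et Vx).
- move=> V s s' t oV sVU ss ss' st x Vx.
  have sss := smooth_sectionD oV ss ss'.
  rewrite -[bracket11 s t x]scale1r -(bracket11_lincl oV sVU) //.
  by congr (bracket11 _ t x); apply: section_ext => y; rewrite scale1r.
- by move=> V s t oV sVU ss st x Vx; exact: (bracket11_anti oV sVU).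
- move=> V f s t oV sVU sf ss st x Vx.
  have s0 := @smooth_section0 R M U (E 1%N) V.
  rewrite (_ : (fun y => _) = fun y => f y *: t y + 0); last first.
    by apply: section_ext => y; rewrite addr0.
  rewrite (bracket11_lin oV sVU sf) //; congr (_ + _).
  by rewrite (bracket11_anti oV sVU ss s0 Vx) (bracket11_zero oV sVU) // oppr0 addr0.
- move=> V s t u oV sVU ss st su x Vx.
  have sm a b : smooth_section _ V a -> smooth_section _ V b ->
    smooth_section _ V (bracket11 a b) by exact: bracket11_smooth.
  rewrite (bracket11_anti oV sVU ss) ?(bracket11_anti oV sVU st) ?(bracket11_anti oV sVU su) //;
    try exact: sm.
  have -> : bracket11 (bracket11 u s) t x = - bracket11 (bracket11 s u) t x.
    have sus := sm _ _ su ss; have ssu := sm _ _ ss su.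
    rewrite -(bracket11_opp oV sVU) //.
    by apply: (bracket11_local oV sVU) => // y Vy; rewrite (bracket11_anti oV sVU).
  have := bracket11_jacobi oV sVU ss st su Vx.
  move: (bracket11 (bracket11 s t) u x) (bracket11 (bracket11 s u) t x) (bracket11
    (bracket11 t u) s x) (d_section _ _).
  move=> a b c d /eqP; rewrite addrC addr_eq0 => /eqP ->.
  by rewrite opprK !opprD opprK [RHS]addrC [- a + b]addrC addrA.
- move=> V f s t u oV sVU sf ss st su x Vx; rewrite /d_section.
  have s0 := @smooth_section0 R M U (E 1%N) V.
  rewrite (_ : (fun y => _) = fun y => f y *: u y + 0); last first.
    by apply: section_ext => y; rewrite addr0.
  by rewrite (bracket111_lin2 oV sVU sf) // (bracket111_zero oV sVU) // addr0 linearZ.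
Qed.

End Degree12.

(** * Brackets at a point *)

Section AtPoint.
Variables (R : realType) (M : manifold R) (U : set M) (F : singular_foliation M).
Variables (W : universal_Linfty U F) (m : M).

Local Notation E := (gr_bundle W).
Local Notation rho := (gr_anchor W).
Local Notation br := (uL_br W).
Local Notation ker u := (anchor_ker rho m u).

Lemma anchor_kerP (u : E 1%N m) :
  reflect (forall f, smooth_near m f -> rho m u f = 0) (ker u).
Proof. exact: asboolP. Qed.

Section Over.
Variables (V : set M) (oV : open V) (sVU : V `<=` U) (Vm : V m).
Local Notation S1 := (smooth_section (E 1%N) V).
Local Notation S2 := (smooth_section (E 2%N) V).

Let shrink V' : open V' -> V' m ->
  [/\ open (V `&` V'), V `&` V' `<=` U, (V `&` V') m, V `&` V' `<=` V &
      V `&` V' `<=` V'].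
Proof.
by move=> oV' V'm; split=> [|x [/sVU]||x []|x []] //; exact: openI.
Qed.

Let sub k (V1 V2 : set M) (s : section (E k)) : smooth_section (E k) V1 s ->
  V2 `<=` V1 -> smooth_section (E k) V2 s.
Proof. by move=> ss h; exact: smooth_section_sub ss. Qed.

(** The derivative term of the Leibniz rule carries rho(s(m)), which is zero. *)
Lemma tensorial_bracket11 s : S1 s -> ker (s m) -> tensorial_at m (fun t => bracket11 s t m).
Proof.
move=> ss /anchor_kerP ks; split=> V' => [t t'|f t t'] oV' sV'U V'm.
  move=> st st' tt; have [oI sIU Im sI sI'] := shrink oV' V'm.
  by apply: (bracket11_local oI sIU) => //; [exact: (sub ss)|exact: (sub st)|move=> x /sI' /tt].
move=> sf st st'; have [oI sIU Im sI sI'] := shrink oV' V'm.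
rewrite (bracket11_lin oI sIU (smooth_on_sub sI' sf) (sub ss sI) (sub st sI') (sub st' sI') Im).
by rewrite ks ?scale0r ?addr0 //; exact: smooth_on_near sf.
Qed.

Lemma tensorial_bracket12 s : S1 s -> ker (s m) -> tensorial_at m (fun t => bracket12 s t m).
Proof.
move=> ss /anchor_kerP ks; split=> V' => [t t'|f t t'] oV' sV'U V'm.
  move=> st st' tt; have [oI sIU Im sI sI'] := shrink oV' V'm.
  by apply: (bracket12_local oI sIU) => //; [exact: (sub ss)|exact: (sub st)|move=> x /sI' /tt].
move=> sf st st'; have [oI sIU Im sI sI'] := shrink oV' V'm.
rewrite (bracket12_lin oI sIU (smooth_on_sub sI' sf) (sub ss sI) (sub st sI') (sub st' sI') Im).
by rewrite ks ?scale0r ?addr0 //; exact: smooth_on_near sf.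
Qed.

Lemma tensorial_bracket12l e : S2 e -> tensorial_at m (fun s => bracket12 s e m).
Proof.
move=> se; split=> V' => [t t'|f t t'] oV' sV'U V'm.
  move=> st st' tt; have [oI sIU Im sI sI'] := shrink oV' V'm.
  by apply: (bracket12_local oI sIU) => //; [exact: (sub st)|exact: (sub se)|move=> x /sI' /tt].
move=> sf st st'; have [oI sIU Im sI sI'] := shrink oV' V'm.
exact: (bracket12_linl oI sIU (smooth_on_sub sI' sf) (sub st sI') (sub st' sI') (sub se sI) Im).
Qed.

Lemma tensorial_bracket111_0 s t : S1 s -> S1 t -> tensorial_at m (fun q => bracket111 q s t m).
Proof.
move=> ss st; split=> V' => [q q'|f q q'] oV' sV'U V'm.
  move=> sq sq' qq; have [oI sIU Im sI sI'] := shrink oV' V'm.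
  by apply: (bracket111_local oI sIU) => //; [exact: (sub sq)|exact: (sub ss)|exact:
    (sub st)|move=> x /sI' /qq].
move=> sf sq sq'; have [oI sIU Im sI sI'] := shrink oV' V'm.
exact: (bracket111_lin0 oI sIU (smooth_on_sub sI' sf) (sub sq sI') (sub sq' sI') (sub
  ss sI) (sub st sI) Im).
Qed.

Lemma tensorial_bracket111_1 s t : S1 s -> S1 t -> tensorial_at m (fun q => bracket111 s q t m).
Proof.
move=> ss st; split=> V' => [q q'|f q q'] oV' sV'U V'm.
  move=> sq sq' qq; have [oI sIU Im sI sI'] := shrink oV' V'm.
  by apply: (bracket111_local oI sIU) => //; [exact: (sub ss)|exact: (sub sq)|exact:
    (sub st)|move=> x /sI' /qq].
move=> sf sq sq'; have [oI sIU Im sI sI'] := shrink oV' V'm.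
exact: (bracket111_lin1 oI sIU (smooth_on_sub sI' sf) (sub ss sI) (sub sq sI') (sub sq'
  sI') (sub st sI) Im).
Qed.

Lemma tensorial_bracket111_2 s t : S1 s -> S1 t -> tensorial_at m (fun q => bracket111 s t q m).
Proof.
move=> ss st; split=> V' => [q q'|f q q'] oV' sV'U V'm.
  move=> sq sq' qq; have [oI sIU Im sI sI'] := shrink oV' V'm.
  by apply: (bracket111_local oI sIU) => //; [exact: (sub ss)|exact: (sub st)|exact:
    (sub sq)|move=> x /sI' /qq].
move=> sf sq sq'; have [oI sIU Im sI sI'] := shrink oV' V'm.
exact: (bracket111_lin2 oI sIU (smooth_on_sub sI' sf) (sub ss sI) (sub st sI) (sub sq
  sI') (sub sq' sI') Im).
Qed.

(** The second argument is replaced while [s m] is in the kernel; then, after antisymmetry, the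
    first one while [t' m] is. *)
Lemma bracket11_at s s' t t' : S1 s -> S1 s' -> S1 t -> S1 t' ->
  s m = s' m -> t m = t' m -> ker (s m) -> ker (t m) -> bracket11 s t m = bracket11 s' t' m.
Proof.
move=> ss ss' st st' es et ks kt.
rewrite (tensorial_at_eq (tensorial_bracket11 ss ks) oV sVU Vm st st' et).
rewrite et in kt.
rewrite (bracket11_anti oV sVU) // (tensorial_at_eq (tensorial_bracket11 st' kt) oV sVU
  Vm ss ss' es).
by rewrite -(bracket11_anti oV sVU).
Qed.

Lemma bracket12_at s s' e e' : S1 s -> S1 s' -> S2 e -> S2 e' ->
  s m = s' m -> e m = e' m -> ker (s m) -> bracket12 s e m = bracket12 s' e' m.
Proof.
move=> ss ss' se se' es ee ks.
rewrite (tensorial_at_eq (tensorial_bracket12 ss ks) oV sVU Vm se se' ee).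
exact: (tensorial_at_eq (tensorial_bracket12l se') oV sVU Vm ss ss' es).
Qed.

Lemma bracket111_at s s' t t' u u' : S1 s -> S1 s' -> S1 t -> S1 t' -> S1 u -> S1 u' ->
  s m = s' m -> t m = t' m -> u m = u' m -> bracket111 s t u m = bracket111 s' t' u' m.
Proof.
move=> ss ss' st st' su su' es et eu.
rewrite (tensorial_at_eq (tensorial_bracket111_0 st su) oV sVU Vm ss ss' es).
rewrite (tensorial_at_eq (tensorial_bracket111_1 ss' su) oV sVU Vm st st' et).
exact: (tensorial_at_eq (tensorial_bracket111_2 ss' st') oV sVU Vm su su' eu).
Qed.

(** By [al_anchor] the anchor of the bracket is the commutator of two vector fields vanishing at
    [m]. *)
Lemma bracket11_ker s t : S1 s -> S1 t -> ker (s m) -> ker (t m) -> ker (bracket11 s t m).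
Proof.
move=> ss st /anchor_kerP ks /anchor_kerP kt; apply/anchor_kerP => f sf.
rewrite (al_anchor (bracket11_almost_lie W) oV sVU ss st Vm sf).
have [V' [oV' V'm sf']] := sf; have [oI sIU Im sI sI'] := shrink oV' V'm.
rewrite ks ?kt ?subrr //; apply: (smooth_on_near oI Im).
  by apply: (smooth_on_anc rho oI sIU); [exact: (sub ss)|exact: smooth_on_sub sf'].
by apply: (smooth_on_anc rho oI sIU); [exact: (sub st)|exact: smooth_on_sub sf'].
Qed.

End Over.

Section Local.
Variables (V : set M) (oV : open V) (sVU : V `<=` U) (Vm : V m).
Local Notation S1 := (smooth_section (E 1%N) V).
Local Notation S2 := (smooth_section (E 2%N) V).

Let shrink V' : open V' -> V' m ->
  [/\ open (V `&` V'), V `&` V' `<=` U, (V `&` V') m, V `&` V' `<=` V &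
      V `&` V' `<=` V'].
Proof.
by move=> oV' V'm; split=> [|x [/sVU]||x []|x []] //; exact: openI.
Qed.

Let sub k (V1 V2 : set M) (s : section (E k)) : smooth_section (E k) V1 s ->
  V2 `<=` V1 -> smooth_section (E k) V2 s.
Proof. by move=> ss h; exact: smooth_section_sub ss. Qed.

Lemma extends_in_degree k (s : section (E k)) :
  smooth_section (E k) V s -> extends (s m) (in_degree s).
Proof.
by move=> ss; exists V; split=> //; [exact: homog_in_degree|rewrite in_degreeE].
Qed.

(** The given extensions show that the set under [xget] is inhabited, and [bracket11_at], on a
    common neighbourhood, shows that whatever extensions were chosen give the same value. *)
Lemma H1_bracketE (u v : H1 W m) s t : S1 s -> S1 t ->
  s m = ker_val u -> t m = ker_val v ->
  ker_val (H1_bracket u v) = bracket11 s t m.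
Proof.
move=> ss st su tv.
have ku : ker (s m) by rewrite su; case: (u).
have kv : ker (t m) by rewrite tv; case: (v).
have : exists w : H1 W m, exists x y, [/\ extends (ker_val u) x,
    extends (ker_val v) y & br [:: x; y] 1%N m = ker_val w].
  exists (KerAt (bracket11_ker oV sVU Vm ss st ku kv)), (in_degree s), (in_degree t).
  by rewrite -su -tv; split=> //; exact: extends_in_degree.
move=> /(xgetPex 0) [x [y [[V1 [oV1 V1m sV1 hx xu]] [V2 [oV2 V2m sV2 hy yv]] <-]]].
have oV12 := openI oV1 oV2.
have [oI sIU Im sI sI'] := shrink oV12 (conj V1m V2m).
have h1 : homog 1 (V `&` (V1 `&` V2)) x by apply: homog_sub hx => z [_ []].
have h2 : homog 1 (V `&` (V1 `&` V2)) y by apply: homog_sub hy => z [_ []].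
rewrite (br2_local oI sIU h1 h2 (homog_eq_in_degree h1) (homog_eq_in_degree h2)) //.
have := h1.2; have := h2.2 => sy sx.
have ssI := sub ss sI; have stI := sub st sI.
rewrite -/(bracket11 _ _ _).
by apply: (bracket11_at oI sIU Im) => //; rewrite ?xu ?yv //; [case: (u)|case: (v)].
Qed.

Lemma H2_actionE (u : H1 W m) (e : H2 W m) s t : S1 s -> S2 t ->
  s m = ker_val u -> t m = e -> H2_action u e = bracket12 s t m.
Proof.
move=> ss st su te.
have ku : ker (s m) by rewrite su; case: (u).
have : exists w : H2 W m, exists x (y : gsection E), [/\ extends (ker_val u) x,
    extends (k := 2) e y & br [:: x; y] 2%N m = w].
  exists (bracket12 s t m), (in_degree s), (in_degree t).
  by rewrite -su -te; split=> //; exact: extends_in_degree.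
move=> /(xgetPex 0) [x [y [[V1 [oV1 V1m sV1 hx xu]] [V2 [oV2 V2m sV2 hy yv]]]]].
rewrite -/(H2_action u e) => <-.
have oV12 := openI oV1 oV2.
have [oI sIU Im sI sI'] := shrink oV12 (conj V1m V2m).
have h1 : homog 1 (V `&` (V1 `&` V2)) x by apply: homog_sub hx => z [_ []].
have h2 : homog 2 (V `&` (V1 `&` V2)) y by apply: homog_sub hy => z [_ []].
rewrite (br2_local oI sIU h1 h2 (homog_eq_in_degree h1) (homog_eq_in_degree h2)) //.
have := h1.2; have := h2.2 => sy sx.
have ssI := sub ss sI; have stI := sub st sI.
rewrite -/(bracket12 _ _ _).
by apply: (bracket12_at oI sIU Im) => //; rewrite ?xu ?yv //; case: (u).
Qed.

Lemma NMRLA_cocycleE (us : 3.-tuple (H1 W m)) s t q : S1 s -> S1 t -> S1 q ->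
  s m = ker_val (tnth us (Ordinal (isT : 0 < 3)%N)) ->
  t m = ker_val (tnth us (Ordinal (isT : 1 < 3)%N)) ->
  q m = ker_val (tnth us (Ordinal (isT : 2 < 3)%N)) ->
  NMRLA_cocycle us = bracket111 s t q m.
Proof.
move=> ss st sq su tu qu.
have : exists w : H2 W m, exists xs : 3.-tuple (gsection E),
    (forall i, extends (ker_val (tnth us i)) (tnth xs i)) /\ br xs 2%N m = w.
  exists (bracket111 s t q m), [tuple in_degree s; in_degree t; in_degree q]; split=> //.
  case=> -[|[|[|//]]] i; rewrite (bool_irrelevance i isT) -?su -?tu -?qu;
    exact: extends_in_degree.
move=> /(xgetPex 0) [xs [hxs]]; rewrite -/(NMRLA_cocycle us) => <-.
have [V0 [oV0 V0m sV0 h0 x0]] := hxs (Ordinal (isT : 0 < 3)%N).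
have [V1 [oV1 V1m sV1 h1 x1]] := hxs (Ordinal (isT : 1 < 3)%N).
have [V2 [oV2 V2m sV2 h2 x2]] := hxs (Ordinal (isT : 2 < 3)%N).
have -> : br xs = br [:: tnth xs (Ordinal (isT : 0 < 3)%N);
    tnth xs (Ordinal (isT : 1 < 3)%N); tnth xs (Ordinal (isT : 2 < 3)%N)].
  by case: xs {hxs h0 h1 h2 x0 x1 x2} => -[|a [|b [|c []]]].
have oV12 := openI oV0 (openI oV1 oV2).
have [oI sIU Im sI sI'] := shrink oV12 (conj V0m (conj V1m V2m)).
pose I := V `&` (V0 `&` (V1 `&` V2)).
have {}h0 : homog 1 I (tnth xs (Ordinal (isT : 0 < 3)%N)) by apply: homog_sub h0 => z [_ []].
have {}h1 : homog 1 I (tnth xs (Ordinal (isT : 1 < 3)%N)) by apply: homog_sub h1 => z [_ [_ []]].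
have {}h2 : homog 1 I (tnth xs (Ordinal (isT : 2 < 3)%N)) by apply: homog_sub h2 => z [_ [_ []]].
rewrite (br3_local oI sIU h0 h1 h2 (homog_eq_in_degree h0) (homog_eq_in_degree h1)
  (homog_eq_in_degree h2)) //.
have {h0 h1 h2} [s0 s1 s2] := And3 h0.2 h1.2 h2.2.
rewrite -/(bracket111 _ _ _ _).
apply: (bracket111_at oI sIU Im) => //; try exact: smooth_section_sub sI _.
- by rewrite x0 su.
- by rewrite x1 tu.
- by rewrite x2 qu.
Qed.

End Local.
End AtPoint.

(** * Lifting through the anchors *)

Section Lifting.
Variables (R : realType) (M : manifold R) (F : singular_foliation M).

(** Local lifts live on neighbourhoods that depend on the index; a frame needs a common one, namely
    the interior of a finite intersection. *)
Lemma finite_shrink (I : finType) (m : M) (P : I -> set M -> Prop) :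
  (forall i V V', P i V -> V' `<=` V -> open V' -> P i V') ->
  (forall i, exists V : set M, [/\ open V, V m & P i V]) ->
  exists V : set M, [/\ open V, V m & forall i, P i V].
Proof.
move=> mono /choice[V HV]; pose A := [set x | forall i, V i x].
have nA : nbhs m A.
  by apply: filter_forall => i; have [oV Vm _] := HV i; exact: open_nbhs_nbhs.
exists A°; split=> [||i]; first exact: open_interior; first exact: nA.
have [_ _ Pi] := HV i; apply: mono Pi _ (@open_interior _ _).
by move=> x /interior_subset /(_ i).
Qed.

(** The two bundles play symmetric roles, as frames are lifted in both directions between A and
    E_{-1}. *)
Lemma lift_sections (U1 U2 V : set M) (E1 : vbundle U1) (E2 : vbundle U2)
    (rho1 : anchor E1) (rho2 : anchor E2) (k : nat) (t : 'I_k -> section E2) (m : M) :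
  anchor_onto F rho1 -> anchor_onto F rho2 ->
  open V -> V m -> V `<=` U1 -> V `<=` U2 -> (forall i, smooth_section E2 V (t i)) ->
  exists N : set M, [/\ open N, N m, N `<=` V & exists s : 'I_k -> section E1,
    forall i, smooth_section E1 N (s i) /\
      vf_eq N (anchor_image rho2 (t i)) (anchor_image rho1 (s i))].
Proof.
move=> [_ on1] [on2 _] oV Vm sV1 sV2 st.
have [|i|N [oN Nm H]] := @finite_shrink 'I_k m (fun i N => N `<=` V /\
    exists s : section E1, smooth_section E1 N s /\
      vf_eq N (anchor_image rho2 (t i)) (anchor_image rho1 s)).
- move=> i N N' [sNV [s [ss ts]]] sNN oN'; split; first exact: subset_trans sNV.
  exists s; split; first exact: smooth_section_sub ss.
  by move=> x f /sNN; exact: ts.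
- have [N [oN Nm sNV [s Hs]]] := on1 V _ oV sV1 (on2 V _ oV sV2 (st i)) m Vm.
  by exists N; split=> //; split=> //; exists s.
pose N' := N `&` V.
have oN' : open N' by exact: openI.
exists N'; split=> //; first by move=> x [].
have /choice[s Hs] : forall i, exists s : section E1, smooth_section E1 N s /\
    vf_eq N (anchor_image rho2 (t i)) (anchor_image rho1 s) by move=> i; have [] := H i.
exists s => i; have [ss ts] := Hs i; split.
  by apply: smooth_section_sub ss => x [].
by move=> x f [Nx _]; exact: ts.
Qed.

(** The anchors of a local frame generate F. For E_{-1} this bounds its rank from below by r. *)
Lemma generated_near_rank (U : set M) (E : vbundle U) (rho : anchor E) (m : M) :
  U m -> anchor_onto F rho -> generated_near F m (vrank E).
Proof.
move=> Um [on1 on2]; have [e fe em] := vframes_cover E Um.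
have [oe seU] := vframes_open fe.
exists e.1, (fun i => anchor_image rho (fun x => tnth (e.2 x) i)); split=> //; split.
  by move=> i; apply: on1 => //; exact: smooth_section_frame.
move=> V Y oV sVe FY x Vx.
have [N [oN Nx sNV [s [ss Ys]]]] := on2 V Y oV (subset_trans sVe seU) FY x Vx.
exists N; split=> //; exists (fun i x => coord (e.2 x) i (s x)); split.
  by move=> i; apply: smooth_coord ss => //; exact: subset_trans sVe.
move=> y f Ny sf; rewrite Ys // /anchor_image.
rewrite {1}(frame_expand (s y) fe (sVe _ (sNV _ Ny))) anc_sum //.
by apply: eq_bigr => i _; rewrite ancZ.
Qed.

End Lifting.

(** * Consequences of minimality at the point *)

Section Spanning.
Variables (R : realType) (M : manifold R) (F : singular_foliation M).
Variables (U Um : set M) (W : universal_Linfty U F) (m : M).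
Hypotheses (hU : open U) (hUm : U m) (hW : minimal_at W m).
Variables (A : vbundle Um) (rhoA : anchor A).
Hypotheses (oUm : open Um) (Umm : Um m) (onA : anchor_onto F rhoA).

Local Notation E := (gr_bundle W).
Local Notation rho := (gr_anchor W).

(* A section killed by the anchor is locally in the image of [d], which
   vanishes at [m] by minimality. *)
Lemma ker_anchor_at (V : set M) (s : section (E 1%N)) : open V -> V `<=` U -> V m ->
  smooth_section (E 1%N) V s -> vf_eq V (anchor_image rho s) (@vf_zero R M) ->
  s m = 0.
Proof.
move=> oV sVU Vm ss s0; have [H _] := gr_exact1 (gr_resolution W) oV sVU ss.
have [N [oN Nm _ [t [_ st]]]] := H s0 m Vm.
by rewrite st // hW // lfunE.
Qed.

Lemma ker_d_at (V : set M) (t : section (E 2%N)) : open V -> V `<=` U -> V m ->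
  smooth_section (E 2%N) V t -> (forall x, V x -> d_section t x = 0) -> t m = 0.
Proof.
move=> oV sVU Vm ss s0; have [H _] := gr_exact (gr_resolution W) oV sVU ss.
have [N [oN Nm _ [u [_ st]]]] := H s0 m Vm.
by rewrite st // hW // lfunE.
Qed.

Lemma lifted_frame_spans (N : set M) e (s : 'I_(vrank A) -> section (E 1%N)) :
  vframes (v := A) e -> open N -> N m -> N `<=` U -> N `<=` e.1 ->
  (forall i, smooth_section (E 1%N) N (s i)) ->
  (forall i, vf_eq N (anchor_image rhoA (fun x => tnth (e.2 x) i))
                     (anchor_image rho (s i))) ->
  (fullv <= <<[tuple s i m | i < vrank A]>>)%VS.
Proof.
move=> fe oN Nm sNU sNe ss As.
have [e' fe' em'] := vframes_cover (E 1%N) hUm.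
have [oe' seU'] := vframes_open fe'.
have [oe seU] := vframes_open fe.
pose V := N `&` e'.1.
have oV : open V by exact: openI.
have [|||||||N' [oN' Nm' sNV [g Hg]]] := @lift_sections R M F Um U V A (E 1%N) rhoA rho
  (vrank (E 1%N)) (fun j x => tnth (e'.2 x) j) m => //.
- exact: (gr_onto (gr_resolution W)).
- by move=> x [/sNe/seU].
- by move=> x [/sNU].
- move=> j; apply: smooth_section_sub (smooth_section_frame j fe').
  by move=> x [].
have sN'N : N' `<=` N by move=> x /sNV[].
have sNU' : N' `<=` U by move=> x /sN'N/sNU.
have sp j : tnth (e'.2 m) j \in <<[tuple s i m | i < vrank A]>>%VS.
  have [sg eg] := Hg j.
  have sc i : smooth_on N' (fun x => coord (e.2 x) i (g j x)).
    by apply: smooth_coord sg => // x /sN'N/sNe.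
  have ssN i : smooth_section (E 1%N) N' (s i) by exact: smooth_section_sub (ss i).
  (* [g j] is a lift to A of the j-th frame section of E_{-1}. The subtracted sum is its image under
     a_i |-> s_i and so has the same anchor; hence [q] vanishes at [m]. *)
  pose q : section (E 1%N) := fun x => tnth (e'.2 x) j -
    \sum_(i < vrank A) coord (e.2 x) i (g j x) *: s i x.
  have sq : smooth_section (E 1%N) N' q.
    apply: smooth_sectionD => //.
      by apply: smooth_section_sub (smooth_section_frame j fe') => x /sNV[].
    apply: smooth_sectionN => //; apply: smooth_section_sum => // i.
    exact: smooth_sectionZ.
  have q0 : vf_eq N' (anchor_image rho q) (@vf_zero R M).
    move=> x f Nx sf; rewrite /anchor_image /vf_zero ancD // ancN //.
    have := eg x f Nx sf; rewrite /anchor_image => ->.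
    rewrite {1}(frame_expand (g j x) fe (sNe _ (sN'N _ Nx))).
    rewrite !anc_sum // -sumrB big1 // => i _; rewrite !ancZ //.
    by have := As i x f (sN'N _ Nx) sf; rewrite /anchor_image => ->; rewrite subrr.
  have /eqP := ker_anchor_at oN' sNU' Nm' sq q0.
  rewrite subr_eq0 => /eqP ->; apply: memv_suml => i _; apply: memvZ.
  by apply: memv_span; apply/mapP; exists i; rewrite ?mem_enum.
apply/subvP => v _; rewrite (frame_expand v fe' em').
by apply: memv_suml => j _; apply: memvZ.
Qed.

End Spanning.

(** * Comparison with a Lie algebroid *)

(** Each action term is paired with the bracket of the two other arguments, so that the three groups
    become the values at the point of [cobound_term]. *)
Lemma CE_diff2E (R : realType) (g V : lmodType R) (br : g -> g -> g) (act : g -> V -> V)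
    (h : 2.-tuple g -> V) (us : 3.-tuple g)
    (u := tnth us (Ordinal (isT : 0 < 3)%N)) (v := tnth us (Ordinal (isT : 1 < 3)%N))
    (w := tnth us (Ordinal (isT : 2 < 3)%N)) :
  CE_diff br act h us =
  (act w (h [tuple u; v]) - h [tuple br u v; w]) -
  (act v (h [tuple u; w]) - h [tuple br u w; v]) +
  (act u (h [tuple v; w]) - h [tuple br v w; u]).
Proof.
have tE (i : 'I_3) (x y : g) : tnth us (lift i ord0) = x -> tnth us (lift i ord_max) = y ->
    [tuple tnth us (lift i k) | k < 2] = [tuple x; y].
  move=> <- <-; apply: eq_from_tnth => -[[|[|//]] k]; rewrite tnth_mktuple;
  by congr (tnth us (lift i _)); apply: val_inj.
have cE (i : 'I_3) (j : 'I_2) (x y z : g) :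
    tnth us (lift i j) = x -> tnth us i = y -> tnth us (lift i (lift j ord0)) = z ->
    [tuple of br (tnth us (lift i j)) (tnth us i) ::
       [tuple tnth us (lift i (lift j k)) | k < 1]] = [tuple br x y; z].
  move=> <- <- <-; apply: val_inj; rewrite /= enum_ordSl /=; congr [:: _, _ & _].
  by apply: size0nil; rewrite size_map size_map size_enum_ord.
rewrite /CE_diff !big_ord_recl !big_ord0.
rewrite [X in _ + (X + _)]big_mkcond [X in _ + (_ + (X + _))]big_mkcond.
rewrite [X in _ + (_ + (_ + (X + _)))]big_mkcond !big_ord_recl !big_ord0.
have tnE (i j : 'I_3) : val i = val j -> tnth us i = tnth us j by move=> /val_inj ->.
rewrite (tE ord0 v w) ?(tE (lift ord0 ord0) u w) ?(tE (lift ord0 (lift ord0 ord0)) u v);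
  try exact: tnE.
rewrite (cE (lift ord0 ord0) ord0 u v w) ?(cE (lift ord0 (lift ord0 ord0)) ord0 u w v)
  ?(cE (lift ord0 (lift ord0 ord0)) (lift ord0 ord0) v w u); try exact: tnE.
rewrite (tnE (lift ord0 (lift ord0 ord0)) (Ordinal (isT : 2 < 3)%N)) //.
rewrite (tnE (lift ord0 ord0) (Ordinal (isT : 1 < 3)%N)) //.
rewrite (tnE ord0 (Ordinal (isT : 0 < 3)%N)) // -/u -/v -/w /=.
rewrite !addr0 !add0r /bump /= !addn0 expr0 expr1 expr2 mulrNN mulr1 !scale1r.
rewrite exprS expr2 !mulN1r opprK !scaleN1r opprB !addrA.
by rewrite [LHS](ACl (3*4*5*2*1*6)).
Qed.

(** Here [a1], [a2], [a3] will be the Jacobi terms of A carried to E_{-1}, [d0] the differential of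
    the ternary bracket and [d1], [d2], [d3] those of the cobounding terms. *)
Lemma jacobi_cancel (R : realFieldType) (T : vectType R) (a1 a2 a3 d0 d1 d2 d3 : T) :
  a1 - a2 + a3 = 0 -> (a1 - d1) - (a2 - d2) + (a3 - d3) + d0 = 0 ->
  d0 - (d1 - d2 + d3) = 0.
Proof.
move=> H1 H2; apply: vect_eq => i; move: H1 H2.
move=> /(congr1 (coord (vbasis fullv) i)) + /(congr1 (coord (vbasis fullv) i)).
rewrite !(linearD, linearB, linearN, linear0) /=; lra.
Qed.

Section Comparison.
Variables (R : realType) (M : manifold R) (F : singular_foliation M).
Variables (U Um : set M) (W : universal_Linfty U F) (A : lie_algebroid Um).

Local Notation E := (gr_bundle W).
Local Notation rho := (gr_anchor W).
Local Notation bA := (la_bundle A).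
Local Notation rhoA := (la_anchor A).
Local Notation r := (vrank bA).

Lemma la_almost_lie : almost_lie rhoA (@la_br _ _ _ A) (fun _ _ _ => fun=> 0).
Proof.
split=> //.
- exact: la_smooth.
- exact: la_local.
- move=> V s s' t oV sVU ss ss' st x Vx.
  rewrite -[la_br s t x]scale1r -(la_linear 1 oV sVU) //.
  by congr (la_br _ t x); apply: section_ext => y; rewrite scale1r.
- exact: la_anti.
- exact: la_leibniz.
- exact: la_jacobi.
- by move=> *; rewrite scaler0.
Qed.

Variables (N : set M) (e : set M * (forall x, r.-tuple (bA x))).
Variable s : 'I_r -> section (E 1%N).
Hypotheses (oN : open N) (sNU : N `<=` U) (sNUm : N `<=` Um).
Hypotheses (fe : vframes e) (sNe : N `<=` e.1).
Hypothesis ss : forall i, smooth_section (E 1%N) N (s i).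

Definition frame_section (i : 'I_r) : section bA := fun x => tnth (e.2 x) i.
Local Notation a := frame_section.

Hypothesis As : forall i,
  vf_eq N (anchor_image rhoA (a i)) (anchor_image rho (s i)).

(** The coefficients are constants, so brackets of such combinations expand bilinearly without
    derivative terms. *)
Definition comb (E' : M -> vectType R) (u : 'I_r -> R) (t : 'I_r -> forall x, E' x) :
  forall x, E' x := fun x => \sum_(i < r) u i *: t i x.

Local Notation au u := (comb u a : section bA).
Local Notation xu u := (comb u s : section (E 1%N)).

(** Over [N] this is the bundle map A -> E_{-1} sending a_i to s_i; it respects the anchors because
    it does so on the frame. *)
Definition frame_lift x (w : bA x) : E 1%N x :=
  \sum_(i < r) coord (e.2 x) i w *: s i x.
Local Notation phi := frame_lift.

Lemma frame_lift_is_linear x : linear (@frame_lift x).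
Proof.
move=> c w w'; rewrite /frame_lift scaler_sumr -big_split /=.
by apply: eq_bigr => i _; rewrite linearP scalerDl scalerA.
Qed.

HB.instance Definition _ x :=
  GRing.isLinear.Build R (bA x) (E 1%N x) _ (@frame_lift x) (@frame_lift_is_linear x).

Lemma frame_liftE x i : N x -> phi (a i x) = s i x.
Proof.
move=> Nx; have := vframes_basis fe (sNe Nx) => /basis_free fr.
rewrite /frame_lift (bigD1 i) //= big1 ?addr0 => [|j ji].
  by rewrite /frame_section (tnth_nth 0) coord_free // eqxx scale1r.
by rewrite /frame_section (tnth_nth 0) coord_free // eq_sym (negbTE ji) scale0r.
Qed.

Lemma frame_lift_comb u x : N x -> phi (au u x) = xu u x.
Proof.
move=> Nx; rewrite linear_sum; apply: eq_bigr => i _.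
by rewrite linearZ /= frame_liftE.
Qed.

Lemma anc_frame_lift x (w : bA x) f : N x -> smooth_near x f ->
  rho x (phi w) f = rhoA x w f.
Proof.
move=> Nx sf; rewrite [in RHS](frame_expand w fe (sNe Nx)) /frame_lift !anc_sum //.
apply: eq_bigr => i _; rewrite !ancZ //; congr (_ * _).
by rewrite -[LHS](As i Nx sf).
Qed.

Lemma smooth_frame_section_on i : smooth_section bA N (a i).
Proof. exact: smooth_section_sub sNe (smooth_section_frame i fe). Qed.

Lemma smooth_comb (U' : set M) (E' : vbundle U') (u : 'I_r -> R) (t : 'I_r -> section E') :
  (forall i, smooth_section E' N (t i)) -> smooth_section E' N (comb u t).
Proof.
by move=> st; apply: smooth_section_sum => // i; exact: smooth_sectionZc.
Qed.

Lemma smooth_coordN i t : smooth_section bA N t ->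
  smooth_on N (fun x => coord (e.2 x) i (t x)).
Proof. exact: smooth_coord. Qed.

Lemma smooth_frame_lift t : smooth_section bA N t ->
  smooth_section (E 1%N) N (fun x => phi (t x)).
Proof.
move=> st; apply: smooth_section_sum => // i; apply: smooth_sectionZ => //.
exact: smooth_coordN.
Qed.

Lemma smooth_la t t' : smooth_section bA N t -> smooth_section bA N t' ->
  smooth_section bA N (la_br t t').
Proof. exact: la_smooth. Qed.

Lemma smooth_bracket11 t t' : smooth_section (E 1%N) N t -> smooth_section (E 1%N) N t' ->
  smooth_section (E 1%N) N (bracket11 t t').
Proof. exact: bracket11_smooth. Qed.

Definition defect i j : section (E 1%N) :=
  fun x => bracket11 (s i) (s j) x - phi (la_br (a i) (a j) x).

Lemma smooth_defect i j : smooth_section (E 1%N) N (defect i j).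
Proof.
apply: smooth_sectionD => //; first exact: smooth_bracket11.
apply: smooth_sectionN => //; apply: smooth_frame_lift.
by apply: smooth_la; exact: smooth_frame_section_on.
Qed.

Lemma defect_anti i j x : N x -> defect j i x = - defect i j x.
Proof.
move=> Nx; rewrite /defect (bracket11_anti oN sNU) // (la_anti oN sNUm) //; try exact:
  smooth_frame_section_on.
by rewrite linearN opprD.
Qed.

Lemma anc_defect i j : vf_eq N (anchor_image rho (defect i j)) (@vf_zero R M).
Proof.
move=> x f Nx sf; rewrite /anchor_image /vf_zero /defect ancD // ancN //.
rewrite anc_frame_lift // (al_anchor la_almost_lie oN sNUm (smooth_frame_section_on i)
  (smooth_frame_section_on j) Nx sf).
rewrite (al_anchor (bracket11_almost_lie W) oN sNU (ss i) (ss j) Nx sf).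
have [V [oV Vx sfV]] := sf; have oVN := openI oV oN.
(* The two inner functions agree only near [x], which is enough since a tangent vector depends on
   germs. *)
have eqA k l : rhoA x (a k x) (fun y => rhoA y (a l y) f) =
    rho x (s k x) (fun y => rho y (s l y) f).
  have sl : smooth_near x (fun y => rho y (s l y) f).
    apply: (smooth_on_near oVN (conj Vx Nx)); apply: smooth_on_anc => //.
    - by move=> y [_ /sNU].
    - by apply: smooth_section_sub (ss l) => y [].
    - by apply: smooth_on_sub sfV => y [].
  rewrite -[RHS](As k Nx sl); rewrite /anchor_image.
  have [tl _ _] := anc_tangent rhoA (a k x) (sNUm Nx).
  apply/esym; apply: (tl _ _ sl).
  apply: filterS (open_nbhs_nbhs (conj oVN (conj Vx Nx))) => y [Vy Ny].
  by rewrite -[LHS](As l Ny (smooth_on_near oV Vy sfV)).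
by rewrite !eqA subrr.
Qed.

Variable K : 'I_r -> 'I_r -> section (E 2%N).
Hypothesis sK : forall i j, smooth_section (E 2%N) N (K i j).
Hypothesis dK : forall i j x, N x -> defect i j x = d_section (K i j) x.

(** K with its first index kept on the frame: brackets in A have variable coefficients, which will
    multiply these sections. *)
Definition correction1 p (w : 'I_r -> R) : section (E 2%N) := comb w (K p).
Definition correction (u w : 'I_r -> R) : section (E 2%N) := comb u (correction1 ^~ w).

Lemma smooth_correction1 p w : smooth_section (E 2%N) N (correction1 p w).
Proof. exact: smooth_comb. Qed.

Lemma smooth_correction u w : smooth_section (E 2%N) N (correction u w).
Proof. by apply: smooth_comb => p; exact: smooth_correction1. Qed.

Lemma d_section_comb u (t : 'I_r -> section (E 2%N)) x :
  d_section (comb u t : section (E 2%N)) x = \sum_(i < r) u i *: d_section (t i) x.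
Proof.
by rewrite /d_section linear_sum; apply: eq_bigr => i _; rewrite linearZ.
Qed.

Lemma bracket11_lift1 p w x : N x ->
  bracket11 (s p) (xu w) x = phi (la_br (a p) (au w) x) + d_section (correction1 p w) x.
Proof.
move=> Nx; rewrite d_section_comb.
rewrite (al_sumr (bracket11_almost_lie W) oN sNU) //; last by move=> i; exact: smooth_sectionZc.
rewrite (al_sumr la_almost_lie oN sNUm) //; first last.
- by move=> i; apply: smooth_sectionZc => //; exact: smooth_frame_section_on.
- exact: smooth_frame_section_on.
rewrite linear_sum -big_split; apply: eq_bigr => i _ /=.
rewrite (al_scaler (bracket11_almost_lie W) oN sNU) //.
rewrite (al_scaler la_almost_lie oN sNUm) //; try exact: smooth_frame_section_on.
by rewrite linearZ -scalerDr -dK // /defect addrCA subrr addr0.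
Qed.

Lemma bracket11_lift u w x : N x ->
  bracket11 (xu u) (xu w) x = phi (la_br (au u) (au w) x) + d_section (correction u w) x.
Proof.
move=> Nx; rewrite d_section_comb.
have sx : smooth_section (E 1%N) N (xu w) by exact: smooth_comb.
have sa : smooth_section bA N (au w) by apply: smooth_comb; exact: smooth_frame_section_on.
rewrite (al_suml (bracket11_almost_lie W) oN sNU) //; last by move=> i; exact: smooth_sectionZc.
rewrite (al_suml la_almost_lie oN sNUm) //; last first.
  by move=> i; apply: smooth_sectionZc => //; exact: smooth_frame_section_on.
rewrite linear_sum -big_split; apply: eq_bigr => i _ /=.
rewrite (al_scalel (bracket11_almost_lie W) oN sNU) //.
rewrite (al_scalel la_almost_lie oN sNUm) //; try exact: smooth_frame_section_on.
by rewrite linearZ bracket11_lift1 // scalerDr.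
Qed.

Definition structure_coef u v p : M -> R :=
  fun x => coord (e.2 x) p (la_br (au u) (au v) x).

(** At the level of sections, w . K(u, v) - K([u, v], w), with [u, v] the bracket of A expanded in
    the frame. *)
Definition cobound_term u v w : section (E 2%N) := fun x =>
  bracket12 (xu w) (correction u v) x - \sum_(p < r) structure_coef u v p x *: correction1 p w x.

Let sxu u : smooth_section (E 1%N) N (xu u). Proof. exact: smooth_comb. Qed.
Let sau u : smooth_section bA N (au u).
Proof. by apply: smooth_comb; exact: smooth_frame_section_on. Qed.

Lemma smooth_structure_coef u v p : smooth_on N (structure_coef u v p).
Proof. by apply: smooth_coordN; exact: smooth_la. Qed.

Lemma smooth_cobound_term u v w : smooth_section (E 2%N) N (cobound_term u v w).
Proof.
apply: smooth_sectionD => //; first by apply: bracket12_smooth => //; exact: smooth_correction.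
apply: smooth_sectionN => //; apply: smooth_section_sum => // p.
by apply: smooth_sectionZ => //; [exact: smooth_structure_coef|exact: smooth_correction1].
Qed.

Lemma bracket11_bracket11_lift u v w x : N x ->
  bracket11 (bracket11 (xu u) (xu v)) (xu w) x =
  phi (la_br (la_br (au u) (au v)) (au w) x) - d_section (cobound_term u v w) x.
Proof.
move=> Nx; have bW := bracket11_almost_lie W; have bL := la_almost_lie.
pose c := structure_coef u v.
have sc p : smooth_on N (c p) by exact: smooth_structure_coef.
have sca p : smooth_section bA N (fun y => c p y *: a p y).
  by apply: smooth_sectionZ => //; exact: smooth_frame_section_on.
have scs p : smooth_section (E 1%N) N (fun y => c p y *: s p y).
  exact: smooth_sectionZ.
have sdK : smooth_section (E 1%N) N (d_section (correction u v)).
  by apply: d_section_smooth => //; exact: smooth_correction.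
have -> : bracket11 (bracket11 (xu u) (xu v)) (xu w) x =
    bracket11 (fun y => (\sum_(p < r) c p y *: s p y) + d_section (correction u v) y) (xu w) x.
  apply: (bracket11_local oN sNU) => //; first exact: smooth_bracket11.
  by move=> y Ny; rewrite bracket11_lift.
rewrite (al_addl bW oN sNU) //; last exact: smooth_section_sum.
rewrite (al_suml bW oN sNU) //.
have -> : la_br (la_br (au u) (au v)) (au w) x =
    la_br (fun y => \sum_(p < r) c p y *: a p y) (au w) x.
  apply: (la_local oN sNUm) => //; first exact: smooth_la.
    exact: smooth_section_sum.
  by move=> y Ny; rewrite [LHS](frame_expand _ fe (sNe Ny)).
rewrite (al_suml bL oN sNUm) //.
(* Bracketing d K(u, v) with the lift of w gives minus d of the action of w on K(u, v). *)
have /eqP := bracket11_d_section oN sNU (smooth_correction u v) (sxu w) Nx.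
rewrite addr_eq0 => /eqP ->.
have -> : d_section (cobound_term u v w) x =
    d_section (bracket12 (xu w) (correction u v)) x - \sum_(p < r) c p x *: d_section
      (correction1 p w) x.
  rewrite /d_section /cobound_term linearB linear_sum; congr (_ - _).
  by apply: eq_bigr => p _; rewrite linearZ.
rewrite opprB addrA; congr (_ - _).
rewrite linear_sum -big_split; apply: eq_bigr => p _ /=.
rewrite (al_leibnizl bW oN sNU) // (al_leibnizl bL oN sNUm) //; last exact: smooth_frame_section_on.
rewrite bracket11_lift1 // linearB !linearZ /= frame_liftE //.
rewrite scalerDr addrAC; congr (_ + _ *: _ + _).
(* What remains are the derivatives of [c p] along [xu w] and along [au w]; they agree because
   [xu w] is the lift of [au w]. *)
rewrite -frame_lift_comb // anc_frame_lift //.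
exact: smooth_on_near (sc p).
Qed.

Lemma d_section_cobound u v w x : N x ->
  d_section (fun y => bracket111 (xu u) (xu v) (xu w) y -
    (cobound_term u v w y - cobound_term u w v y + cobound_term v w u y)) x = 0.
Proof.
move=> Nx; have := bracket11_jacobi oN sNU (sxu u) (sxu v) (sxu w) Nx.
have := al_jacobi_left la_almost_lie oN sNUm (sau u) (sau v) (sau w) Nx.
rewrite !bracket11_bracket11_lift // oppr0 => /(congr1 (@frame_lift x)).
rewrite linearD linearB linear0 /=.
move: (cobound_term u v w) (cobound_term u w v) (cobound_term v w u) (bracket111 _ _ _).
move=> k1 k2 k3 k0; rewrite /d_section /= => H.
have -> (t0 t1 t2 t3 : E 2%N x) : gr_d W 1 x (t0 - (t1 - t2 + t3)) =
    gr_d W 1 x t0 - (gr_d W 1 x t1 - gr_d W 1 x t2 + gr_d W 1 x t3).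
  by rewrite [LHS]linearB [X in _ - X]linearD [X in _ - (X + _)]linearB.
exact: jacobi_cancel.
Qed.

(** * Evaluation at the point *)

Variable m : M.
Hypotheses (Nm : N m) (hW : minimal_at W m).
Hypothesis K_anti : forall i j, K j i m = - K i j m.
Local Notation sm := [tuple s i m | i < r].
Hypothesis s_basis : basis_of fullv sm.

(** The coordinates are those of the whole fibre E_{-1}|_m, of which H^{-1} is a subspace. *)
Definition ker_coord (u : H1 W m) : 'I_r -> R := fun i => coord sm i (ker_val u).

Lemma comb_ker_coord u : xu (ker_coord u) m = ker_val u.
Proof.
rewrite [RHS](coord_basis s_basis (memvf _)); apply: eq_bigr => i _.
by rewrite -tnth_nth tnth_mktuple.
Qed.

Lemma ker_coord_lin c (u v : H1 W m) i :
  ker_coord (c *: u + v) i = c * ker_coord u i + ker_coord v i.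
Proof. by rewrite /ker_coord -linearP. Qed.

Lemma coord_lifted_frame p i : coord sm p (s i m) = (p == i)%:R.
Proof.
have -> : s i m = sm`_i by rewrite -tnth_nth tnth_mktuple.
by rewrite coord_free ?(basis_free s_basis) // eq_sym.
Qed.

(** By minimality d K vanishes at [m], so there the bracket of the lifts is the lift of the bracket
    of A. *)
Lemma ker_coord_bracket u v p :
  ker_coord (H1_bracket u v) p = structure_coef (ker_coord u) (ker_coord v) p m.
Proof.
rewrite /ker_coord (H1_bracketE oN sNU Nm (sxu (ker_coord u)) (sxu (ker_coord v)));
  try exact: comb_ker_coord.
rewrite bracket11_lift // /d_section hW // lfunE addr0 /frame_lift linear_sum (bigD1 p) //= big1.
  by rewrite linearZ /= coord_lifted_frame eqxx mulr1 addr0.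
by move=> i ip; rewrite linearZ /= coord_lifted_frame eq_sym (negbTE ip) mulr0.
Qed.

Definition correction_at (xs : 2.-tuple (H1 W m)) : H2 W m :=
  correction (ker_coord (tnth xs ord0)) (ker_coord (tnth xs ord_max)) m.

Lemma comb_lin (E' : M -> vectType R) (t : 'I_r -> forall x, E' x) u v w c x :
  (forall i, w i = c * u i + v i) -> comb w t x = c *: comb u t x + comb v t x.
Proof.
move=> wE; rewrite /comb scaler_sumr -big_split; apply: eq_bigr => i _.
by rewrite wE scalerDl scalerA.
Qed.

Lemma correction_linl u v w q c x : (forall i, w i = c * u i + v i) ->
  correction w q x = c *: correction u q x + correction v q x.
Proof. exact: comb_lin. Qed.

Lemma correction_linr u v w q c x : (forall i, w i = c * u i + v i) ->
  correction q w x = c *: correction q u x + correction q v x.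
Proof.
move=> wE; rewrite /correction /comb scaler_sumr -big_split; apply: eq_bigr => i _ /=.
by rewrite /correction1 (comb_lin _ _ wE) scalerDr !scalerA mulrC.
Qed.

Lemma correction_alt u : correction u u m = 0.
Proof.
have E2 : correction u u m = \sum_(i < r) \sum_(j < r) (u i * u j) *: K i j m.
  apply: eq_bigr => i _; rewrite /correction1 /comb scaler_sumr.
  by apply: eq_bigr => j _; rewrite scalerA.
(* The coefficients [u i * u j] are symmetric and the [K i j m] antisymmetric, so exchanging the
   indices changes the sign. *)
have : correction u u m = - correction u u m.
  rewrite {1}E2 exchange_big E2 -sumrN; apply: eq_bigr => i _ /=.
  rewrite -sumrN; apply: eq_bigr => j _.
  by rewrite K_anti scalerN mulrC.
move=> /eqP; rewrite -addr_eq0 -mulr2n -scaler_nat scaler_eq0 pnatr_eq0 /=.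
by move/eqP.
Qed.

Lemma CE_cochain_correction_at : CE_cochain correction_at.
Proof.
split=> [xs i c u v|xs i j ij xij].
  have [i0|i1] : i = ord0 \/ i = ord_max.
    by case: i => -[|[|//]] ?; [left|right]; apply: val_inj.
  - rewrite i0 /correction_at !tnth_mktuple /=.
    exact: correction_linl (ker_coord_lin c u v).
  - rewrite i1 /correction_at !tnth_mktuple /=.
    exact: correction_linr (ker_coord_lin c u v).
have -> : correction_at xs = correction (ker_coord (tnth xs i)) (ker_coord (tnth xs i)) m.
  have {ij} [[iE jE]|[iE jE]] : (i = ord0 /\ j = ord_max) \/ (i = ord_max /\ j = ord0).
    move: ij; rewrite -val_eqE; case: i {xij} => -[|[|//]] ?; case: j => -[|[|//]] ? //= _.
      by left; split; apply: val_inj.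
    by right; split; apply: val_inj.
  - by rewrite /correction_at -iE -jE -xij.
  - by rewrite /correction_at -iE -jE -xij.
exact: correction_alt.
Qed.

(** The constant combinations extend the elements of H^{-1}, and the structure functions at [m] are
    the coordinates of their bracket. *)
Lemma cobound_term_at u v w :
  cobound_term (ker_coord u) (ker_coord v) (ker_coord w) m =
  H2_action w (correction_at [tuple u; v]) - correction_at [tuple H1_bracket u v; w].
Proof.
rewrite (H2_actionE oN sNU Nm (sxu (ker_coord w))
  (smooth_correction (ker_coord u) (ker_coord v)) (comb_ker_coord w)) //.
congr (_ - _); apply: eq_bigr => p _.
by rewrite ker_coord_bracket.
Qed.

Lemma NMRLA_cocycle_coboundary us :
  NMRLA_cocycle us = CE_diff (@H1_bracket _ _ _ _ W m) (@H2_action _ _ _ _ W m) correction_at us.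
Proof.
pose u := tnth us (Ordinal (isT : 0 < 3)%N).
pose v := tnth us (Ordinal (isT : 1 < 3)%N).
pose w := tnth us (Ordinal (isT : 2 < 3)%N).
rewrite (NMRLA_cocycleE oN sNU Nm (sxu (ker_coord u)) (sxu (ker_coord v))
  (sxu (ker_coord w)) (comb_ker_coord u) (comb_ker_coord v) (comb_ker_coord w)).
have := ker_d_at hW oN sNU Nm _ (fun x => @d_section_cobound (ker_coord u) (ker_coord
  v) (ker_coord w) x).
move=> /(_ _)/eqP; rewrite subr_eq0 => /(_ _)/eqP ->; last first.
  apply: smooth_sectionD => //; first exact: bracket111_smooth.
  apply: smooth_sectionN => //; apply: smooth_sectionD => //; last exact: smooth_cobound_term.
  apply: smooth_sectionD => //; first exact: smooth_cobound_term.
  by apply: smooth_sectionN => //; exact: smooth_cobound_term.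
by rewrite !cobound_term_at CE_diff2E.
Qed.

End Comparison.

(** * Choice of an antisymmetric correction *)

Section CorrectionExists.
Variables (R : realType) (M : manifold R) (F : singular_foliation M).
Variables (U Um : set M) (W : universal_Linfty U F) (A : lie_algebroid Um).

Local Notation E := (gr_bundle W).
Local Notation rho := (gr_anchor W).
Local Notation bA := (la_bundle A).
Local Notation rhoA := (la_anchor A).
Local Notation r := (vrank bA).

Lemma correction_exists (N : set M) (e : set M * (forall x, r.-tuple (bA x)))
    (s : 'I_r -> section (E 1%N)) (m : M) :
  open N -> N `<=` U -> N `<=` Um -> vframes e -> N `<=` e.1 -> N m ->
  (forall i, smooth_section (E 1%N) N (s i)) ->
  (forall i, vf_eq N (anchor_image rhoA (frame_section e i)) (anchor_image rho (s i))) ->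
  exists V : set M, [/\ open V, V m, V `<=` N &
    exists K : 'I_r -> 'I_r -> section (E 2%N),
    [/\ forall i j, smooth_section (E 2%N) V (K i j),
        forall i j x, V x -> defect e s i j x = d_section (K i j) x &
        forall i j x, K j i x = - K i j x]].
Proof.
move=> oN sNU sNUm fe sNe Nm ss As.
have [|[i j]|V [oV Vm H]] := @finite_shrink _ _ ('I_r * 'I_r)%type m (fun ij V =>
    exists k : section (E 2%N), smooth_section (E 2%N) V k /\
      forall x, V x -> defect e s ij.1 ij.2 x = d_section k x).
- move=> ij V V' [k [sk dk]] sVV oV'; exists k; split.
    exact: smooth_section_sub sk.
  by move=> x /sVV; exact: dk.
- have sD := smooth_defect oN sNU sNUm fe sNe ss i j.
  have [ex _] := gr_exact1 (gr_resolution W) oN sNU sD.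
  have [V [oV Vm _ Hk]] := ex (anc_defect oN sNU sNUm fe sNe ss As i j) m Nm.
  by exists V.
have {H} /choice[k Hk] : forall ij : 'I_r * 'I_r, exists k : section (E 2%N),
  smooth_section (E 2%N) V k /\ forall x, V x -> defect e s ij.1 ij.2 x = d_section k x := H.
pose V' := V `&` N.
have oV' : open V' by exact: openI.
have sV : V' `<=` V by move=> x [].
exists V'; split=> //; first by move=> x [].
(* The preimages [k (i, j)] and [k (j, i)] were chosen independently. Half their difference is still
   a preimage, the defect being antisymmetric, and it makes the cochain alternating. *)
exists (fun i j x => 2^-1 *: (k (i, j) x - k (j, i) x)); split.
- move=> i j; apply: smooth_sectionZc => //; apply: smooth_sectionD => //.
    exact: smooth_section_sub (Hk (i, j)).1.
  by apply: smooth_sectionN => //; exact: smooth_section_sub (Hk (j, i)).1.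
- move=> i j x [Vx Nx]; rewrite /d_section linearZ linearB /=.
  have /= := (Hk (i, j)).2 x Vx; rewrite /d_section => <-.
  have /= := (Hk (j, i)).2 x Vx; rewrite /d_section => <-.
  rewrite (defect_anti oN sNU sNUm fe sNe ss i j Nx) opprK scalerDr -scalerDl.
  have -> : 2^-1 + 2^-1 = 1 :> R by lra.
  by rewrite scale1r.
- by move=> i j x; rewrite -scalerN opprB.
Qed.

End CorrectionExists.

(** Classes are cosets, so adding or subtracting [h] in the primitive passes from one to the other.
    This rests on additivity of [CE_diff] in the cochain, which reduces to that of [act]. *)
Lemma CE_class_coboundary (R : realType) (g V : lmodType R) (br : g -> g -> g)
    (act : g -> V -> V) n (h : n.+1.-tuple g -> V) (w : n.+2.-tuple g -> V) :
  (forall u, {morph act u : x y / x + y}) -> CE_cochain h ->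
  (forall xs, w xs = CE_diff br act h xs) ->
  CE_class br act w = CE_class br act (fun=> 0).
Proof.
move=> actD hC wE.
have actN u x : act u (- x) = - act u x.
  have a0 : act u 0 = 0.
    have /eqP := actD u 0 0; rewrite addr0.
    by rewrite -[X in X == _]addr0 (inj_eq (addrI _)) eq_sym => /eqP.
  by apply/eqP; rewrite -addr_eq0 -actD addNr a0.
have diffD h1 h2 xs : CE_diff br act (fun ys => h1 ys + h2 ys) xs =
    CE_diff br act h1 xs + CE_diff br act h2 xs.
  rewrite /CE_diff addrACA; congr (_ + _); rewrite -big_split /=.
    by apply: eq_bigr => i _; rewrite actD scalerDr.
  apply: eq_bigr => i _; rewrite -big_split; apply: eq_bigr => j _.
  by rewrite scalerDr.
have diffN h1 xs : CE_diff br act (fun ys => - h1 ys) xs = - CE_diff br act h1 xs.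
  rewrite /CE_diff opprD -!sumrN; congr (_ + _).
    by apply: eq_bigr => i _; rewrite actN scalerN.
  apply: eq_bigr => i _; rewrite -sumrN; apply: eq_bigr => j _.
  by rewrite scalerN.
have cochD h1 h2 : CE_cochain h1 -> CE_cochain h2 ->
    @CE_cochain R g V n.+1 (fun ys => h1 ys + h2 ys).
  move=> [l1 a1] [l2 a2]; split=> [xs i c u v|xs i j ij xij].
    by rewrite l1 l2 scalerDr addrACA.
  by rewrite (a1 _ _ _ ij xij) (a2 _ _ _ ij xij) addr0.
have cochN h1 : CE_cochain h1 -> @CE_cochain R g V n.+1 (fun ys => - h1 ys).
  move=> [l1 a1]; split=> [xs i c u v|xs i j ij xij].
    by rewrite l1 opprD scalerN.
  by rewrite (a1 _ _ _ ij xij) oppr0.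
rewrite predeqE => w'; split=> -[w'C [k kC kE]]; split=> //.
  exists (fun ys => k ys + h ys); first exact: cochD.
  by move=> xs; rewrite diffD -kE -wE subr0 subrK.
exists (fun ys => k ys + - h ys); first by apply: cochD => //; exact: cochN.
by move=> xs; rewrite diffD diffN -kE -wE subr0.
Qed.

(** The action is defined through a choice of extensions, so additivity is read off from explicit
    ones over a common neighbourhood. *)
Lemma H2_actionD (R : realType) (M : manifold R) (F : singular_foliation M)
    (U : set M) (W : universal_Linfty U F) (m : M) (hU : open U) (hUm : U m)
    (u : H1 W m) : {morph @H2_action _ _ _ _ W m u : x y / x + y}.
Proof.
have ext k (v : gr_bundle W k m) : exists V (t : section (gr_bundle W k)),
    [/\ open V, V m, V `<=` U, smooth_section (gr_bundle W k) V t & t m = v].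
  have [e fe em] := vframes_cover (gr_bundle W k) hUm.
  have [oe seU] := vframes_open fe.
  (* Freezing the coordinates at [m] extends any fibre element over a whole frame domain. *)
  exists e.1, (fun x => \sum_i coord (e.2 m) i v *: tnth (e.2 x) i); split=> //.
    apply: smooth_section_sum => // i; apply: smooth_sectionZc => //.
    exact: smooth_section_frame.
  by rewrite [RHS](frame_expand v fe em).
move=> x y.
have [V0 [s [oV0 V0m sV0 ss su]]] := ext _ (ker_val u).
have [V1 [t [oV1 V1m sV1 st tx]]] := ext _ x.
have [V2 [t' [oV2 V2m sV2 st' ty]]] := ext _ y.
pose V := V0 `&` (V1 `&` V2).
have oV : open V by do 2 (apply: openI => //).
have Vm : V m by [].
have sVU : V `<=` U by move=> z [/sV0].
have {}ss : smooth_section _ V s by apply: smooth_section_sub ss => z [].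
have {}st : smooth_section _ V t by apply: smooth_section_sub st => z [_ []].
have {}st' : smooth_section _ V t' by apply: smooth_section_sub st' => z [_ []].
rewrite (H2_actionE oV sVU Vm ss st su tx) (H2_actionE oV sVU Vm ss st' su ty).
have stt : smooth_section _ V (fun z => 1 *: t z + t' z).
  exact: smooth_section_lin (smooth_on_cst V 1) st st'.
rewrite (H2_actionE oV sVU Vm ss stt su); last by rewrite scale1r tx ty.
rewrite (bracket12_lin oV sVU (smooth_on_cst V 1) ss st st' Vm).
by rewrite (anc_cst _ oV sVU) // scale0r addr0 scale1r.
Qed.

Theorem proposition4p29
  (R : realType) (M : manifold R) (F : singular_foliation M)
  (hres : exists G : geometric_resolution setT F, finite_length G)
  (m : M) (r : nat) (hr : foliation_rank F m r)
  (U : set M) (hU : open U) (hUm : U m)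
  (W : universal_Linfty U F) (hW : minimal_at W m)
  (hclass : ~ NMRLA_class_vanishes W m) :
  ~ exists (Um : set M) (A : lie_algebroid Um),
      [/\ open Um, Um m, vrank (la_bundle A) = r
        & anchor_onto F (la_anchor A)].
Proof.
move=> [Um [A [oUm Umm rA onA]]]; apply: hclass.
have onW := gr_onto (gr_resolution W).
have [e fe em] := vframes_cover (la_bundle A) Umm.
have [oe seU] := vframes_open fe.
pose V0 := U `&` e.1.
have oV0 : open V0 by exact: openI.
have [||||N0 [oN0 N0m sN0 [s Hs]]] := @lift_sections R M F U Um V0 _ _
  (gr_anchor W) (la_anchor A) _ (frame_section e) m onW onA oV0.
- by [].
- by move=> x [].
- by move=> x [_ /seU].
- move=> i; apply: smooth_section_sub (smooth_section_frame i fe).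
  by move=> x [].
have sN0U : N0 `<=` U by move=> x /sN0[].
have sN0e : N0 `<=` e.1 by move=> x /sN0[].
have sN0Um : N0 `<=` Um by move=> x /sN0e/seU.
have ss0 i := (Hs i).1; have As0 i := (Hs i).2.
have sp := lifted_frame_spans hUm hW onA fe oN0 N0m sN0U sN0e ss0 As0.
have s_basis : basis_of fullv [tuple s i m | i < vrank (la_bundle A)].
  have [e' fe' em'] := vframes_cover (gr_bundle W 1%N) hUm.
  (* A spanning family is a basis once it has at most as many members as the dimension; here r <=
     rank E_{-1}, since a frame of E_{-1} yields generators of F. *)
  rewrite basisEdim sp size_tuple (size_basis (vframes_basis fe' em')) rA.
  exact: hr.2 _ (generated_near_rank hUm onW).
have [N [oN Nm sN [K [sK dK K_anti]]]] :=
  correction_exists oN0 sN0U sN0Um fe sN0e N0m ss0 As0.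
rewrite /NMRLA_class_vanishes /NMRLA_class.
apply: (CE_class_coboundary (h := correction_at (m := m) s K)).
- exact: H2_actionD.
- exact: CE_cochain_correction_at.
- apply: (NMRLA_cocycle_coboundary oN _ _ fe) => //.
  + by move=> x /sN/sN0U.
  + by move=> x /sN/sN0Um.
  + by move=> x /sN/sN0e.
  + by move=> i; exact: smooth_section_sub (ss0 i).
  + by move=> i x f /sN; exact: As0.
Qed.
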